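(* Let $q$ be a prime power, $m$ a non-negative integer and let $\mathcal{L}=\langle x^{q^{\ell_1}},\ldots,x^{q^{\ell_s}}\rangle\subset\mathbb{F}_{q^m}[x]$ be the $\mathbb{F}_{q^m}$-linear span of the indicated monomials, where $1\le \ell_1<\ell_2<\cdots<\ell_s<\frac m2$. If $\mathcal{L}$ is an even rank family, then the cyclic codes $\mathcal{C}_{\mathcal{L},1}$ and $\mathcal{C}_{\mathcal{L},2}$ have dimensions $m(s+1)$ and $m(s+1)+1$ over $\mathbb{F}_q$, respectively, and their weight distributions are as follows (frequencies attached to coinciding weights are to be added). (1) $\mathcal{C}_{\mathcal{L},1}$: weight $0$ with frequency $1$; weight $q^m-q^{m-1}$ with frequency $\sum_{r\in R_{\mathcal{L}}}M_r(q^m-q^r)$; and, for each $r\in R_{\mathcal{L}}$ and $i\in\{1,2\}$: weight $q^m-q^{m-1}+(-1)^i(q-1)q^{m-\frac r2-1}$ with frequency $M_{r,i}\big(q^{r-1}+(-1)^{i+1}(q-1)q^{\frac r2-1}\big)$; weight $q^m-q^{m-1}+(-1)^{i+1}q^{m-\frac r2-1}$ with frequency $M_{r,i}\big(q^{r-1}+(-1)^{i}q^{\frac r2-1}\big)(q-1)$. (2) $\mathcal{C}_{\mathcal{L},2}$: all the weights with the frequencies listed in (1), and in addition: weight $q^m-1$ with frequency $q-1$; weight $q^m-q^{m-1}-1$ with frequency $(q-1)\sum_{r\in R_{\mathcal{L}}}M_r(q^m-q^r)$; and, for each $r\in R_{\mathcal{L}}$ and $i\in\{1,2\}$: weight $q^m-q^{m-1}-1+(-1)^i(q-1)q^{m-\frac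 r2-1}$ with frequency $M_{r,i}\big(q^{r-1}+(-1)^{i}q^{\frac r2-1}\big)(q-1)$; weight $q^m-q^{m-1}-1+(-1)^{i+1}q^{m-\frac r2-1}$ with frequency $M_{r,i}\big(q^r-q^{r-1}+(-1)^{i+1}q^{\frac r2-1}\big)(q-1)$.
   Context: A function $Q:\mathbb{F}_{q^m}\to\mathbb{F}_q$ is a quadratic form if, after identifying $\mathbb{F}_{q^m}\simeq\mathbb{F}_q^m$ as $\mathbb{F}_q$-spaces, it is given by a homogeneous polynomial of degree 2 in $m$ variables over $\mathbb{F}_q$. Its rank $r$ is the minimum number of variables needed to represent $Q$ (up to invertible linear change of variables); equivalently the codimension of $\{y: Q(y)=0,\ Q(x+y)=Q(x)\ \forall x\in\mathbb{F}_{q^m}\}$. If $r$ is even, then $\#\{x:Q(x)=0\}=q^{m-1}+\varepsilon_Q(q-1)q^{m-\frac r2-1}$ for a unique sign $\varepsilon_Q\in\{\pm1\}$; $Q$ is of type 1 if $\varepsilon_Q=+1$ and of type 3 if $\varepsilon_Q=-1$. $\mathrm{Tr}_{q^m/q}$ is the trace from $\mathbb{F}_{q^m}$ to $\mathbb{F}_q$. For $R\in\mathcal{L}$ put $Q_R(x)=\mathrm{Tr}_{q^m/q}(xR(x))$. $\mathcal{L}$ is an even rank family if $Q_R$ has even rank for every $R\in\mathcal{L}$. For $r\ge 0$ let $M_{r,1}$ (resp. $M_{r,2}$) be the number of $R\in\mathcal{L}\smallsetminus\{0\}$ such that $Q_R$ has rank $r$ and is of type 1 (resp. type 3), let $M_r$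 be the number of all $R\in\mathcal{L}$ (including $R=0$ when $r=0$) such that $Q_R$ has rank $r$, and let $R_{\mathcal{L}}=\{r: \exists R\in\mathcal{L}\text{ with }Q_R\text{ of rank }r\}$ (so $0\in R_{\mathcal{L}}$ and $M_0=1$ here). The codes, of length $q^m-1$ over $\mathbb{F}_q$ (coordinates indexed by $\mathbb{F}_{q^m}^*$, ordered by powers of a primitive element), are $\mathcal{C}_{\mathcal{L},1}=\{(\mathrm{Tr}_{q^m/q}(xR(x)+\beta x))_{x\in\mathbb{F}_{q^m}^*}: R\in\mathcal{L},\ \beta\in\mathbb{F}_{q^m}\}$ and $\mathcal{C}_{\mathcal{L},2}=\{(\mathrm{Tr}_{q^m/q}(xR(x)+\beta x)+b)_{x\in\mathbb{F}_{q^m}^*}: R\in\mathcal{L},\ \beta\in\mathbb{F}_{q^m},\ b\in\mathbb{F}_q\}$. The weight of a codeword is its number of nonzero coordinates; the frequency of a weight is the number of codewords with that weight. *)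

(* Defs.v *)
From HB Require Import structures.
From mathcomp Require Import all_boot all_order all_algebra all_fingroup.
From mathcomp Require Import all_field qpoly boolp mpoly.

Set Implicit Arguments.
Unset Strict Implicit.
Unset Printing Implicit Defensive.

Import GRing.Theory Num.Theory.
Local Open Scope ring_scope.

(* F is the field with q elements and finvect_type K, which is K with its     *)
(* finite field and splitting field structures, is its extension of degree m. *)

Section QuadraticForms.

Variables (F : finFieldType) (K : fieldExtType F).
Local Notation fK := (finvect_type K).
Local Notation q := (#|F|).
Local Notation m := (\dim {:K}).

(* galTrace takes its values in the copy 1%VS of F inside K; Tr is the        *)
(* corresponding element of F, see TrE.                                       *)
Definition Tr (x : fK) : F :=
  coord [tuple (1 : fK)] ord0 (galTrace 1 {:fK} x).

Fact TrE (x : fK) : (Tr x)%:A = galTrace 1 {:fK} x.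
Proof.
have : galTrace 1 {:fK} x \in <<[tuple (1%R : fK)]>>%VS.
  by rewrite span_seq1 mem_galTrace ?memvf ?finField_galois ?sub1v.
by move/coord_span->; rewrite big_ord1.
Qed.

(* Q is a homogeneous quadratic polynomial in the first r coordinates with    *)
(* respect to some F-basis of K.                                              *)
Definition quad_repr (Q : fK -> F) (r : nat) : Prop :=
  exists (b : m.-tuple fK) (le_rm : (r <= m)%N) (g : {mpoly F[r]}),
    [/\ basis_of {:fK} b, g \is 2.-homog
      & forall x, Q x = g.@[fun i : 'I_r => coord b (widen_ord le_rm i) x]].

(* The value is only meaningful for a quadratic form Q, that is, when         *)
(* quad_repr Q m holds.                                                       *)
Definition qrank (Q : fK -> F) : 'I_m.+1 :=
  [arg min_(r < (ord_max : 'I_m.+1) | `[< quad_repr Q r >]) (r : nat)].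

Definition has_sign (Q : fK -> F) (e : rat) : bool :=
  ~~ odd (qrank Q) &&
  (#|[set x : fK | Q x == 0%R]|%:R ==
     q%:R ^ (m%:Z - 1)
     + e * (q%:R - 1) * q%:R ^ (m%:Z - (qrank Q)./2%:Z - 1)).

Definition qtype1 (Q : fK -> F) : bool := has_sign Q 1.
Definition qtype3 (Q : fK -> F) : bool := has_sign Q (-1).

End QuadraticForms.

Section Codes.

Variables (F : finFieldType) (K : fieldExtType F).
Local Notation fK := (finvect_type K).
Local Notation q := (#|F|).
Local Notation m := (\dim {:K}).
(* Polynomials over K of degree less than q ^ m. *)
Local Notation polyK := {poly_(#|F| ^ \dim {:K}) (finvect_type K)}.

(* npolyp does not truncate the monomials, as l < m. *)
Definition span_mono (ell : seq nat) : {vspace polyK} :=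
  <<[seq npolyp (q ^ m) 'X^(q ^ l) | l <- ell]>>%VS.

Definition QR (R : polyK) (x : fK) : F := Tr (x * (R : {poly fK}).[x]).

Variable L : {vspace polyK}.

Definition even_rank_family : Prop :=
  forall R : polyK, R \in L -> ~~ odd (qrank (QR R)).

Definition Mrank (r : nat) : nat :=
  #|[set R : polyK in L | qrank (QR R) == r :> nat]|.

(* i = 1 counts forms of type 1 and i = 2 forms of type 3. *)
Definition Mtype (r i : nat) : nat :=
  #|[set R : polyK in L | [&& R != 0, qrank (QR R) == r :> nat
      & if i == 1%N then qtype1 (QR R) else qtype3 (QR R)]]|.

Definition ranks : {set 'I_m.+1} := [set qrank (QR R) | R : polyK in L].

Local Notation n := (#|F| ^ \dim {:K}).-1.

(* Coordinate i of a word is the one indexed by alpha ^+ i in K^*.            *)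
Definition word1 (alpha : fK) (R : polyK) (beta : fK) : 'rV[F]_n :=
  \row_(i < n) let x := alpha ^+ i in
    Tr (x * (R : {poly fK}).[x] + beta * x).

Definition word2 (alpha : fK) (R : polyK) (beta : fK) (b : F) : 'rV[F]_n :=
  \row_(i < n) let x := alpha ^+ i in
    (Tr (x * (R : {poly fK}).[x] + beta * x) + b).

Definition code1 (alpha : fK) : {set 'rV[F]_n} :=
  [set word1 alpha R beta | R : polyK in L, beta : fK in [set: fK]].

Definition code2 (alpha : fK) : {set 'rV[F]_n} :=
  [set word2 alpha R p.1 p.2 | R : polyK in L, p : fK * F in [set: fK * F]].

(* Weight distributions are lists of (weight, frequency) rows. Integer        *)
(* exponents are used because the exponents in the frequencies are negative   *)
(* for r = 0.                                                                 *)
Local Notation Q := (q%:R : rat).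
Local Notation W := (Q ^ m%:Z - Q ^ (m%:Z - 1)).
Local Notation sg k := ((-1) ^+ k : rat).
Local Notation wexp r := (m%:Z - r./2%:Z - 1).

Definition balanced : rat :=
  \sum_(r in ranks) (Mrank r)%:R * (Q ^ m%:Z - Q ^ r%:Z).

Definition rows1 (r i : nat) : seq (rat * rat) :=
  [:: (W + sg i * (Q - 1) * Q ^ wexp r,
       (Mtype r i)%:R
         * (Q ^ (r%:Z - 1) + sg i.+1 * (Q - 1) * Q ^ (r./2%:Z - 1)));
      (W + sg i.+1 * Q ^ wexp r,
       (Mtype r i)%:R
         * (Q ^ (r%:Z - 1) + sg i * Q ^ (r./2%:Z - 1)) * (Q - 1))].

Definition rows2 (r i : nat) : seq (rat * rat) :=
  [:: (W - 1 + sg i * (Q - 1) * Q ^ wexp r,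
       (Mtype r i)%:R
         * (Q ^ (r%:Z - 1) + sg i * Q ^ (r./2%:Z - 1)) * (Q - 1));
      (W - 1 + sg i.+1 * Q ^ wexp r,
       (Mtype r i)%:R
         * (Q ^ r%:Z - Q ^ (r%:Z - 1) + sg i.+1 * Q ^ (r./2%:Z - 1))
         * (Q - 1))].

Definition table1 : seq (rat * rat) :=
  [:: (0, 1); (W, balanced)]
  ++ flatten [seq rows1 r i | r : 'I_m.+1 <- enum ranks, i : nat <- [:: 1%N; 2%N]].

Definition table2 : seq (rat * rat) :=
  table1 ++ [:: (Q ^ m%:Z - 1, Q - 1); (W - 1, (Q - 1) * balanced)]
  ++ flatten [seq rows2 r i | r : 'I_m.+1 <- enum ranks, i : nat <- [:: 1%N; 2%N]].

End Codes.

Section LinearCodes.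

Variables (F : finFieldType) (n : nat).
Implicit Types (C : {set 'rV[F]_n}) (c : 'rV[F]_n).

Definition linear_code_of_dim C (k : nat) : Prop :=
  exists2 U : {vspace 'rV[F]_n}, C =i U & \dim U = k.

Definition cyclic_code C : Prop :=
  forall c, c \in C -> \row_i c ord0 (ord_pred i) \in C.

Definition weight c : nat := #|[set i | c ord0 i != 0]|.

(* Frequencies of rows of tbl with the same weight are added. *)
Definition has_weight_distribution C (tbl : seq (rat * rat)) : Prop :=
  forall w : rat,
    #|[set c in C | (weight c)%:R == w]|%:R = \sum_(p <- tbl | p.1 == w) p.2.

End LinearCodes.

(* Main.v *)
From HB Require Import structures.
Require Import Defs.
From mathcomp Require Import all_boot all_order all_algebra all_fingroup all_field.
From mathcomp Require Import ring lra zify.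
From mathcomp Require Import qpoly boolp mpoly.

(** The word of (R, beta, b) lists the values, at the nonzero points, of the
    function f(x) = Q_R(x) + Tr(beta x) + b, where Q_R(x) = Tr(x R(x)). Its
    weight is therefore known once the zeros of f on the whole field are counted,
    and f is a quadratic form plus an affine function. Write B for the polar form
    B(x, y) = Q_R(x + y) - Q_R(x) - Q_R(y), W for the radical of B and r for the
    rank of Q_R.

    Even rank means that Q_R vanishes on W (qrank_even). In general r is the
    codimension of the space of zeros of Q_R in W. In odd characteristic
    2 Q_R(x) = B(x, x), so Q_R always vanishes on W. In characteristic 2 the
    restriction of Q_R to W is additive and semilinear, so its zeros have
    codimension at most 1 in W; as B is alternating, W has even codimension, and
    the parity of r decides.

    The number of solutions of Q_R(x) = c is then governed by one sign
    (level_distribution), in every characteristic at once. A vector v outside W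
    with Q_R(v) = 0 cuts the problem down to the hyperplane orthogonal to v, since
    off this hyperplane the lines parallel to v meet every level set once. When no
    such v is left, the mean square of the level sizes, which counts the pairs
    with Q_R(x) = Q_R(y), is so small that the dimension modulo W must be 2 and
    that all nonzero levels have the same size (anisotropic_level).

    Now let beta vary. If Tr(beta .) is nonzero on W, shifts along W show that f
    takes each value equally often (zeros_balanced). Otherwise Tr(beta .) = B(x0, .)
    for some x0 (polar_image, a duality obtained from the trace pairing) and
    f(x) = Q_R(x + x0) - Q_R(x0) + b, so the zeros of f form a level set of Q_R
    (zeros_image). Each such beta comes from #|W| vectors x0, so counting the beta
    with a given weight becomes counting the x0 with a given value of Q_R, which
    is the level distribution again (card_zeros_eq). This yields the frequencies
    contributed by each R.

    Finally B(x, y) = Tr(P(x) y) for a Frobenius polynomial P whose exponents are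
    the l_i and the m - l_i. Because 2 l_i < m these are distinct, so P = 0 only
    if R = 0, and a nonzero R has rank at least 2. The zero counts then leave no
    room for a word of weight 0 other than that of (0, 0, 0) (weight0_word2).
    Hence the words are in bijection with the triples, which gives the dimensions,
    and the weight distributions are obtained by summing over R. The form R = 0 is
    handled by the same formulas as a form of rank 0 and type 1. *)

Set Implicit Arguments.
Unset Strict Implicit.
Unset Printing Implicit Defensive.

Import Order.TTheory GRing.Theory Num.Theory.
Local Open Scope ring_scope.

(** * Mean square deviation of functions on a finite field *)
Section NonzeroSums.

Variable F : finFieldType.
Local Notation q := #|F|.

Lemma sum1_nonzero : \sum_(c : F | c != 0) (1 : rat) = q%:R - 1.
Proof.
have -> : q%:R - 1 = q.-1%:R :> rat.
  by rewrite -subn1 natrB // ltnW ?finNzRing_gt1.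
by rewrite -(cardC1 (0 : F)) -sumr_const; apply: eq_bigl => c; rewrite inE.
Qed.

(** For D of mean zero, the summand vanishes for all c <> 0 exactly when D is
    constant off 0. An upper bound on the second moment of D is thus both a bound
    on D 0 and, in the equality case, a proof that D is constant off 0. *)
Lemma sum_sqr_deviation (D : F -> rat) : \sum_c D c = 0 ->
  \sum_(c | c != 0) ((q%:R - 1) * D c + D 0) ^+ 2 =
  (q%:R - 1) ^+ 2 * (\sum_c D c ^+ 2) - q%:R * (q%:R - 1) * D 0 ^+ 2.
Proof.
move=> sumD0; set a : rat := q%:R - 1.
have s1 : \sum_(c | c != 0) D c = - D 0.
  by move: sumD0; rewrite (bigD1 0) //= addrC => /eqP; rewrite addr_eq0 => /eqP.
have s2 : \sum_(c | c != 0) D c ^+ 2 = \sum_c D c ^+ 2 - D 0 ^+ 2.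
  by rewrite [in RHS](bigD1 0) //= addrAC subrr add0r.
have s0 : \sum_(c : F | c != 0) (1 : rat) = a by exact: sum1_nonzero.
transitivity (\sum_(c | c != 0)
    (a ^+ 2 * D c ^+ 2 + 2%:R * a * D 0 * D c + D 0 ^+ 2 * 1)).
  by apply: eq_bigr => c _; ring.
rewrite !big_split /= -!mulr_sumr s2 s0 s1 (_ : q%:R = a + 1 :> rat); first by ring.
by rewrite /a subrK.
Qed.

End NonzeroSums.

(** * Quadratic forms on subspaces *)
Section QuadraticSpace.

Variables (F : finFieldType) (vT : vectType F).
Local Notation V := (finvect_type vT).
Local Notation q := #|F|.

(** Moving x by a multiple of u that depends on t x alone sends each fibre of g
    injectively into any other one. All equidistribution statements below are
    instances: t is constant for linear functionals and for forms perturbed by a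
    functional, and is the polar form for points off a hyperplane. *)
Lemma card_shift_fiber (A : {set V}) (g t : V -> F) (u : V) (c : F) :
    {in A, forall x, t x != 0} ->
    (forall x a, x \in A ->
      [/\ x + a *: u \in A, t (x + a *: u) = t x
        & g (x + a *: u) = g x + a * t x]) ->
  (q * #|[set x in A | g x == c]| = #|A|)%N.
Proof.
move=> t_neq0 shiftA; pose fib b := [set x in A | g x == b].
have le_fib b b' : (#|fib b| <= #|fib b'|)%N.
  pose h x := x + ((b' - b) / t x) *: u.
  have h_inj : {in fib b &, injective h}.
    move=> x y; rewrite !inE => /andP[Ax _] /andP[Ay _] eq_h.
    have [_ tx _] := shiftA x ((b' - b) / t x) Ax.
    have [_ ty _] := shiftA y ((b' - b) / t y) Ay.
    have txy : t x = t y by rewrite -tx -ty -!/(h _) eq_h.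
    by move: eq_h; rewrite /h txy => /addIr.
  rewrite -(card_in_imset h_inj); apply/subset_leq_card/subsetP => _ /imsetP[x + ->].
  rewrite inE => /andP[Ax /eqP gx].
  have [Ah _ gh] := shiftA x ((b' - b) / t x) Ax.
  by rewrite inE Ah gh gx divfK ?t_neq0 // addrC subrK /=.
have -> : (#|A| = \sum_(b : F) #|fib b|)%N.
  rewrite -sum1_card (partition_big g predT) //=; apply: eq_bigr => b _.
  by rewrite -sum1_card; apply: eq_bigl => x; rewrite inE.
rewrite -sum_nat_const; apply: eq_bigr => b _.
by apply/eqP; rewrite eqn_leq !le_fib.
Qed.

Lemma card_lfun_fiber (U : {vspace V}) (f : 'Hom(V, F^o)) (u : V) (c : F) :
  u \in U -> f u != 0 -> (q * #|[set x in U | f x == c]| = #|U|)%N.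
Proof.
move=> Uu fu.
have <- : #|[set x in U]| = #|U| by rewrite cardsE.
rewrite -(@card_shift_fiber [set x in U] f (fun=> f u) u c) //; last first.
  move=> x a; rewrite !inE => Ux; split=> //; first by rewrite rpredD ?rpredZ.
  by rewrite linearD linearZ.
by congr (_ * _)%N; apply: eq_card => x; rewrite !inE.
Qed.

Variable S : 'Hom(V, 'Hom(V, F^o)).

(** S need not be symmetric: every quadratic form is of the form S x x, also in
    characteristic 2, where a symmetric S would not suffice. *)
Definition qf (x : V) : F := S x x.

Definition polar_fun (v x : V) : F^o := S v x + S x v.

Fact polar_fun_linear v : linear (polar_fun v).
Proof.
move=> a x y; rewrite /polar_fun !linearD !linearZ !add_lfunE !scale_lfunE /=.
by rewrite /GRing.scale /=; ring.
Qed.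

HB.instance Definition _ v :=
  GRing.isLinear.Build F V F^o _ (polar_fun v) (polar_fun_linear v).

Definition polar v : 'Hom(V, F^o) := linfun (polar_fun v).

Lemma qfE x : qf x = S x x.
Proof. by []. Qed.

Lemma polarE v x : polar v x = S v x + S x v.
Proof. by rewrite lfunE. Qed.

Lemma polarC v x : polar v x = polar x v.
Proof. by rewrite !polarE addrC. Qed.

Lemma polarDl u v x : polar (u + v) x = polar u x + polar v x.
Proof. by rewrite -!(polarC x) linearD. Qed.

Lemma polarZl a v x : polar (a *: v) x = a * polar v x.
Proof. by rewrite -!(polarC x) linearZ. Qed.

Lemma qfD x y : qf (x + y) = qf x + qf y + polar x y.
Proof.
rewrite /qf polarE !linearD /= !add_lfunE; ring.
Qed.

Lemma qfZ a x : qf (a *: x) = a ^+ 2 * qf x.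
Proof. by rewrite /qf !linearZ /= scale_lfunE /GRing.scale /= expr2 -mulrA. Qed.

Lemma polarxx x : polar x x = 2%:R * qf x.
Proof. by rewrite polarE /qf mulr_natl mulr2n. Qed.

Lemma qf0 : qf 0 = 0.
Proof. by rewrite /qf linear0. Qed.

Definition polar_perp (U : {vspace V}) (v : V) : {vspace V} := (U :&: lker (polar v))%VS.

Definition radical (U : {vspace V}) : {vspace V} :=
  (U :&: \bigcap_(v : V | v \in U) lker (polar v))%VS.

Lemma polar_perpP U v x : (x \in polar_perp U v) = (x \in U) && (polar v x == 0).
Proof. by rewrite memv_cap memv_ker. Qed.

Lemma radicalP (U : {vspace V}) x :
  reflect (x \in U /\ {in U, forall y, polar x y = 0}) (x \in radical U).
Proof.
apply: (iffP memv_capP) => [] [Ux] => [/subv_bigcapP xR | xR]; split=> //.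
  by move=> y Uy; apply/eqP; rewrite polarC -memv_ker; apply: xR.
rewrite memvE; apply/subv_bigcapP => y Uy.
by rewrite -memvE memv_ker polarC xR.
Qed.

Lemma radicalS U : (radical U <= U)%VS.
Proof. exact: capvSl. Qed.

Section Reduction.
Variables (U : {vspace V}) (v : V).
Hypotheses (Uv : v \in U) (nRv : v \notin radical U) (vv0 : polar v v = 0).

Lemma notin_radical_witness : exists2 u, u \in U & polar v u != 0.
Proof.
move: nRv; apply: contraNP => /forall2NP noU; apply/radicalP; split=> // y Uy.
by have [//|/negP/negPn/eqP] := noU y.
Qed.

Lemma dim_polar_perp : (\dim (polar_perp U v)).+1 = \dim U.
Proof.
have [u Uu vu] := notin_radical_witness.
suffices im1 : \dim (polar v @: U) = 1%N.
  by rewrite -(limg_ker_dim (polar v) U) im1 addn1.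
apply/eqP; rewrite eqn_leq lt0n dimv_eq0 (leq_trans (dimvS (subvf _))) ?dimvf //=.
apply: contraNneq vu => im0; rewrite -memv0 -im0.
exact: memv_img.
Qed.

(** Passing to the hyperplane orthogonal to an isotropic v removes a hyperbolic
    plane without choosing a complement: the dimension drops by one and the
    radical gains v, so the codimension of the radical drops by two. *)
Lemma radical_polar_perp : radical (polar_perp U v) = (radical U + <[v]>)%VS.
Proof.
have [u Uu vu] := notin_radical_witness.
apply/vspaceP => y; apply/radicalP/memv_addP => [[]|].
  rewrite polar_perpP => /andP[Uy vy] yR.
  (* polar y and polar v both vanish on the hyperplane, so they are proportional
     on U; a is the ratio, read off at u. *)
  pose a := polar y u / polar v u.
  exists (y - a *: v); last by exists (a *: v); rewrite ?subrK ?memvZ ?memv_line.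
  apply/radicalP; split=> [|x Ux]; first by rewrite rpredB ?rpredZ.
  pose b := polar v x / polar v u.
  have /yR : x - b *: u \in polar_perp U v.
    rewrite polar_perpP rpredB ?rpredZ //= linearB linearZ /= /b.
    by rewrite /GRing.scale /= divfK ?subrr.
  rewrite linearB linearZ /= => /subr0_eq yx.
  rewrite -scaleNr polarDl polarZl yx /a /b /GRing.scale /=.
  by field.
case=> w /radicalP[Uw wR] [_ /vlineP[a ->] ->]; split.
  rewrite polar_perpP rpredD ?rpredZ //= linearD linearZ /= vv0 polarC wR //.
  by rewrite scaler0 addr0.
move=> x; rewrite polar_perpP => /andP[Ux /eqP vx].
by rewrite polarDl polarZl vx wR // mulr0 addr0.
Qed.

Lemma dim_radical_polar_perp : \dim (radical (polar_perp U v)) = (\dim (radical U)).+1.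
Proof.
rewrite radical_polar_perp dimv_disjoint_sum ?dim_vline; last first.
  apply/eqP; rewrite -subv0; apply/subvP => x /memv_capP[Rx /vlineP[a xE]].
  rewrite memv0 xE scaler_eq0; apply: contraNT nRv; rewrite negb_or => /andP[a0 _].
  by rewrite -[v](scalerK a0) -xE rpredZ.
rewrite (_ : v != 0) ?addn1 //.
by apply: contraNneq nRv => ->; rewrite rpred0.
Qed.

End Reduction.

(** Every vector is isotropic for an alternating form, so the reduction to a
    hyperplane applies until only the radical is left. *)
Lemma alternating_codim_even (U : {vspace V}) :
  {in U, forall x, polar x x = 0} -> ~~ odd (\dim U - \dim (radical U)).
Proof.
have [n] := ubnP (\dim U); elim: n U => // n IHn U /ltnSE leUn alt.
have [UR | /subvPn[v Uv nRv]] := boolP (U <= radical U)%VS.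
  by rewrite (eqP (_ : _ - _ == 0)%N) // subn_eq0 dimvS.
have dU := dim_polar_perp Uv nRv; have dR := dim_radical_polar_perp Uv nRv (alt v Uv).
have sub_o : {subset polar_perp U v <= U} by apply/subvP; exact: capvSl.
have le_d := dimvS (radicalS (polar_perp U v)).
have := IHn (polar_perp U v); rewrite dU => /(_ leUn) IH.
have : ~~ odd (\dim (polar_perp U v) - \dim (radical (polar_perp U v))).
  by apply: IH => x /sub_o; apply: alt.
rewrite -dU; rewrite dR in le_d *.
by rewrite subSn ?(ltnW le_d) // -(subnSK le_d) /= negbK.
Qed.

Definition level (U : {vspace V}) (c : F) : nat :=
  #|[set x in U | qf x == c]|.

Lemma sum_level U : (\sum_c level U c = #|U|)%N.
Proof.
rewrite -sum1_card (partition_big qf predT) //=; apply: eq_bigr => c _.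
by rewrite /level -sum1_card; apply: eq_bigl => x; rewrite inE.
Qed.

(** The left-hand sum counts the pairs (x, x + y) with equal values. For fixed y
    the condition is qf y + polar y x = 0, which is affine in x, and is void
    precisely when y is in the radical. *)
Lemma sum_level_sqr U : {in radical U, forall x, qf x = 0} ->
  (q * \sum_c level U c ^ 2 = #|U| ^ 2 + q.-1 * #|radical U| * #|U|)%N.
Proof.
move=> qR0.
have -> : (\sum_c level U c ^ 2 =
           \sum_(y in U) #|[set x in U | polar y x == - qf y]|)%N.
  under eq_bigr => c _ do rewrite -mulnn {1}/level -sum_nat_const.
  rewrite (exchange_big_dep (mem U)) /=; last by move=> c x _; rewrite inE => /andP[].
  under eq_bigr => x Ux.
    rewrite (big_pred1 (qf x)); last by move=> c; rewrite inE Ux eq_sym.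
    rewrite /level -sum1_card (reindex_inj (addrI x)) /=.
    under eq_bigl => y do rewrite inE (rpredDl _ Ux).
    over.
  rewrite (exchange_big_dep (mem U)) /=; last by move=> x y _ /andP[].
  apply: eq_bigr => y Uy; rewrite -sum1_card; apply: eq_bigl => x.
  rewrite inE Uy /=; congr (_ && _); rewrite qfD (polarC x y).
  by rewrite -subr_eq0 -[RHS]subr_eq0; congr (_ == 0); ring.
rewrite big_distrr /=.
transitivity (\sum_(y in U) (#|U| + (y \in radical U) * (q.-1 * #|U|)))%N.
  apply: eq_bigr => y Uy; have [yR | nyR] := boolP (y \in radical U).
    rewrite mul1n -mulSn prednK ?(ltnW (finNzRing_gt1 _)) //.
    congr (_ * _)%N; rewrite -[RHS]cardsE; apply: eq_card => x; rewrite !inE.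
    have [Ux|//] := boolP (x \in U); case/radicalP: (yR) => _ -> //.
    by rewrite qR0 // oppr0 eqxx.
  have [u Uu yu] := notin_radical_witness Uy nyR.
  by rewrite (card_lfun_fiber _ Uu yu) addn0.
rewrite big_split /= sum_nat_const mulnn -big_distrl /= mulnCA mulnA.
congr (_ + _ * _ * _)%N; rewrite -sum1_card [RHS]big_mkcond [LHS]big_mkcond /=.
apply: eq_bigr => y _; have [yR|_] := boolP (y \in radical U); last by case: ifP.
by rewrite (subvP (radicalS U) _ yR).
Qed.

(** Off the hyperplane orthogonal to v, each line of direction v meets each level
    exactly once, so the excess of a level over the mean lies on the hyperplane. *)
Lemma level_polar_perp (U : {vspace V}) v c :
    v \in U -> v \notin radical U -> qf v = 0 ->
  (q * level U c + #|polar_perp U v| = q * level (polar_perp U v) c + #|U|)%N.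
Proof.
move=> Uv nRv qv0; pose A := [set x in U | polar v x != 0].
have UE (P : pred V) : #|[set x in U | P x]| =
    (#|[set x in polar_perp U v | P x]| + #|[set x in A | P x]|)%N.
  rewrite -(cardsID [set x in polar_perp U v]); congr (_ + _)%N; apply: eq_card => x.
    by rewrite !inE polar_perpP; case: (x \in U); rewrite ?andbF //= andbC.
  by rewrite !inE polar_perpP; case: (x \in U); rewrite ?andbF //= andbC.
have cardE (W : {vspace V}) : #|W| = #|[set x in W | predT x]|.
  by rewrite -cardsE; apply: eq_card => x; rewrite !inE andbT.
rewrite /level UE (cardE U) UE -cardE mulnDr -addnA; congr (_ + _)%N.
rewrite [RHS]addnC; congr (_ + _)%N.
rewrite (@card_shift_fiber A qf (polar v) v) => [|x|x a].
- by apply: eq_card => x; rewrite [RHS]inE andbT.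
- by rewrite inE => /andP[].
rewrite !inE => /andP[Ux vx].
have vv0 : polar v v = 0 by rewrite polarxx qv0 mulr0.
have vxE : polar v (x + a *: v) = polar v x.
  by rewrite linearD linearZ /= vv0 scaler0 addr0.
rewrite vxE vx rpredD ?rpredZ //; split=> //.
by rewrite qfD qfZ qv0 mulr0 addr0 polarC polarZl.
Qed.

Let q_gt1 : 1 < q%:R :> rat.
Proof. by rewrite ltr1n finNzRing_gt1. Qed.

(** The level of 0 is the radical, hence far below the mean. The second moment
    only allows this if the dimension modulo the radical is 2, and then with
    equality, which forces the nonzero levels to be equal. *)
Lemma anisotropic_level (U : {vspace V}) (k : nat) :
    {in U, forall x, (qf x == 0) = (x \in radical U)} ->
    \dim U = (\dim (radical U) + k.+1.*2)%N ->
  forall c, q%:R * (level U c)%:R = #|U|%:R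
    - (q%:R * (c == 0)%:R - 1) * q%:R ^+ (\dim (radical U) + k.+1) :> rat.
Proof.
move=> aniso dimU.
have qR0 : {in radical U, forall x, qf x = 0}.
  by move=> x Rx; apply/eqP; rewrite aniso // (subvP (radicalS U)).
have level0 : level U 0 = #|radical U|.
  rewrite -[RHS]cardsE; apply: eq_card => x; rewrite !inE.
  have [Ux|nUx] := boolP (x \in U); first by rewrite aniso.
  by apply/esym/negbTE; apply: contra nUx; apply/subvP/radicalS.
set w : rat := #|radical U|%:R; set y : rat := q%:R ^+ k.+1.
have w_gt0 : 0 < w by rewrite /w card_vspace natrX exprn_gt0 // (lt_trans ltr01).
have UE : #|U|%:R = w * y ^+ 2.
  by rewrite /w /y !card_vspace dimU !natrX exprD -exprM muln2.
pose D c : rat := q%:R * (level U c)%:R - #|U|%:R.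
have sumN : \sum_c (level U c)%:R = #|U|%:R :> rat.
  by rewrite -natr_sum sum_level.
have sumD : \sum_c D c = 0.
  by rewrite sumrB -mulr_sumr sumN sumr_const -[#|U|%:R *+ _]mulr_natl subrr.
have sumN2 : q%:R * (\sum_c (level U c)%:R ^+ 2) =
    #|U|%:R ^+ 2 + (q%:R - 1) * w * #|U|%:R :> rat.
  have := congr1 (fun n => n%:R : rat) (sum_level_sqr qR0).
  rewrite natrD !natrM natr_sum -subn1 natrB ?(ltnW (finNzRing_gt1 _)) // => <-.
  by congr (_ * _); apply: eq_bigr => c _; rewrite natrX.
have sumD2 : \sum_c D c ^+ 2 = q%:R * (q%:R - 1) * w ^+ 2 * y ^+ 2.
  transitivity (\sum_c (q%:R * (q%:R * (level U c)%:R ^+ 2 : rat)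
     - 2%:R * q%:R * #|U|%:R * (level U c)%:R + #|U|%:R ^+ 2 * 1)).
    by apply: eq_bigr => c _; rewrite /D; ring.
  rewrite big_split sumrB /= -!mulr_sumr sumN2 sumN sumr_const UE.
  by ring.
have D0 : D 0 = q%:R * w - w * y ^+ 2 by rewrite /D level0 UE.
have := sum_sqr_deviation sumD; rewrite sumD2 D0.
set s := \sum_(c | _) _ => sE.
have s_ge0 : 0 <= s by apply: sumr_ge0 => c _; apply: sqr_ge0.
(* Only the last factor can be negative, and s >= 0: this gives y = q and s = 0. *)
have {}sE : s = q%:R * (q%:R - 1) * w ^+ 2 * (y + 1)
                * (y * (q%:R - 1) + (y ^+ 2 - q%:R)) * (q%:R - y).
  by rewrite sE; ring.
have le_qy : q%:R <= y.
  by rewrite /y exprS ler_peMr ?exprn_ege1 // ?ltW // (lt_trans ltr01).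
have y_gt0 : 0 < y by apply: lt_le_trans le_qy; apply: lt_trans q_gt1.
have coef_gt0 : 0 < q%:R * (q%:R - 1) * w ^+ 2 * (y + 1)
                * (y * (q%:R - 1) + (y ^+ 2 - q%:R)).
  have q0 : 0 < q%:R :> rat by apply: lt_trans q_gt1.
  have q1 : 0 < q%:R - 1 :> rat by rewrite subr_gt0.
  have y2 : q%:R < y ^+ 2 by nra.
  rewrite !mulr_gt0 ?exprn_gt0 //; first by rewrite addr_gt0.
  by rewrite addr_gt0 ?subr_gt0 ?mulr_gt0.
have yq : y = q%:R.
  apply/le_anti; rewrite le_qy andbT -subr_ge0.
  by rewrite -(pmulr_rge0 _ coef_gt0) -sE.
have s0 : s = 0 by rewrite sE yq subrr mulr0.
have expE : q%:R ^+ (\dim (radical U) + k.+1) = w * q%:R :> rat.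
  by rewrite exprD -/y yq /w card_vspace natrX.
move=> c; rewrite expE.
have [->|c0] := eqVneq c 0; first by rewrite level0 UE -/w yq /=; ring.
have /eqP := s0; rewrite psumr_eq0 => [|d _]; last exact: sqr_ge0.
move/allP/(_ c (mem_index_enum c)); rewrite c0 /= expf_eq0 /= => /eqP.
have q1 : q%:R - 1 != 0 :> rat by rewrite subr_eq0 gt_eqF.
rewrite yq /D => Dc; apply/eqP; rewrite -subr_eq0; apply/eqP.
apply: (mulfI q1); rewrite [RHS]mulr0 -[RHS]Dc UE yq /=; ring.
Qed.

(** With k half the rank, the sign e is false for a sum of hyperbolic planes and
    true when an anisotropic plane remains. *)
Theorem level_distribution (U : {vspace V}) (k : nat) :
    {in radical U, forall x, qf x = 0} ->
    \dim U = (\dim (radical U) + k.*2)%N ->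
  exists e : bool, forall c, q%:R * (level U c)%:R = #|U|%:R
    + (-1) ^+ e * (q%:R * (c == 0)%:R - 1) * q%:R ^+ (\dim (radical U) + k) :> rat.
Proof.
elim: k U => [|k IHk] U qR0 dimU.
  have RU : radical U = U.
    by apply/eqP; rewrite eqEdim radicalS dimU addn0 leqnn.
  exists false => c; rewrite addn0 RU expr0 mul1r card_vspace natrX.
  rewrite [level U c](_ : _ = (c == 0%R) * #|U|)%N; last first.
    rewrite -[#|U| in RHS]cardsE; have [->|c0] := eqVneq c 0.
      rewrite mul1n; apply: eq_card => x; rewrite !inE.
      by have [Ux|//] := boolP (x \in U); rewrite qR0 ?RU ?eqxx.
    apply: eq_card0 => x; rewrite !inE.
    by have [Ux|//] := boolP (x \in U); rewrite qR0 ?RU // eq_sym (negbTE c0).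
  by rewrite natrM card_vspace natrX; case: (c == 0); ring.
have [[v [Uv nRv qv0]] | aniso] := pselect (exists v,
    [/\ v \in U, v \notin radical U & qf v = 0]); last first.
  exists true => c; rewrite expr1 mulN1r mulNr.
  apply: anisotropic_level => // x Ux; apply/eqP/idP => [qx0|/qR0//].
  by apply/negPn/negP => nRx; apply: aniso; exists x.
have vv0 : polar v v = 0 by rewrite polarxx qv0 mulr0.
have dR := dim_radical_polar_perp Uv nRv vv0; have dU := dim_polar_perp Uv nRv.
have [x||e eE] := IHk (polar_perp U v).
- rewrite radical_polar_perp // => /memv_addP[w Rw [_ /vlineP[a ->] ->]].
  case/radicalP: (Rw) => _ wR.
  by rewrite qfD qfZ qv0 mulr0 addr0 qR0 // linearZ /= wR // scaler0 addr0.
- by apply: eq_add_S; rewrite dR dU dimU; lia.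
exists e => c; have := congr1 (fun n => n%:R : rat) (level_polar_perp c Uv nRv qv0).
rewrite !natrD !natrM eE dR addSnnS => lvlU.
apply/eqP; rewrite -(inj_eq (addIr (#|polar_perp U v|%:R : rat))) lvlU.
by rewrite addrAC (addrAC #|U|%:R) (addrC #|U|%:R).
Qed.

End QuadraticSpace.

(** * Rank and radical *)
Section QuadraticRank.

Variables (F : finFieldType) (K : fieldExtType F).
Local Notation V := (finvect_type K).
Local Notation m := (\dim {:K}).
Variable S : 'Hom(V, 'Hom(V, F^o)).
Local Notation qf := (qf S).
Local Notation radical := (radical S fullv).
Local Notation polar := (polar S).

(** The rank is the codimension of the largest singular subspace. *)
Definition singular (Z : {vspace V}) : Prop :=
  (Z <= radical)%VS /\ {in Z, forall x, qf x = 0}.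

(** In a basis adapted to Z and a complement, the coordinates along Z do not
    change the value of qf. *)
Lemma quad_repr_singular Z : singular Z -> quad_repr qf (m - \dim Z).
Proof.
case=> ZR qZ; rewrite -(dimv_compl Z); set r := \dim Z^C.
pose b := (vbasis Z^C ++ vbasis Z)%SEQ.
have b_basis : basis_of {:V} b.
  rewrite -(addv_complf Z) addvC; apply: cat_basis; rewrite ?vbasisP //.
  by apply/directv_addP; rewrite capvC capv_compl.
have sz_b : size b == m.
  by rewrite size_cat !size_tuple -/r /r dimv_compl subnK // dimvS ?subvf.
have le_rm : (r <= m)%N by rewrite /r dimvS ?subvf.
pose bt := Tuple sz_b.
pose g : {mpoly F[r]} := \sum_i \sum_j
  (S (b`_(i : 'I_r)) (b`_(j : 'I_r)) : F) *: ('X_i * 'X_j).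
exists bt, le_rm, g; split=> //.
  apply: rpred_sum => i _; apply: rpred_sum => j _; apply: rpredZ.
  by rewrite -[2%N]/(1 + 1)%N dhomogM // dhomogX /= mdeg1.
move=> x; set c := fun i => _.
pose u := \sum_(i < r) c i *: b`_i.
have Zxu : x - u \in Z.
  rewrite {1}(coord_basis (b_basis : basis_of _ bt) (memvf x)).
  rewrite (bigID (fun i : 'I_m => i < r)%N) /= big_ord_narrow addrAC subrr add0r.
  apply: rpred_sum => i; rewrite -leqNgt => le_ri; apply: rpredZ.
  rewrite nth_cat size_tuple ltnNge le_ri /= vbasis_mem // mem_nth // size_tuple.
  have := ltn_ord i; rewrite -{2}(eqP sz_b) size_cat !size_tuple => ltir.
  by rewrite ltn_subLR.
have -> : qf x = qf u.
  rewrite -[x in LHS](subrK u) qfD qZ // add0r.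
  by case/radicalP: (subvP ZR _ Zxu) => _ -> //; rewrite ?addr0 // memvf.
have Sl y : S u y = \sum_(i < r) c i * S b`_i y.
  rewrite /u linear_sum /= sum_lfunE; apply: eq_bigr => i _.
  by rewrite linearZ /= scale_lfunE.
have Sr y : S y u = \sum_(i < r) c i * S y b`_i.
  by rewrite /u linear_sum; apply: eq_bigr => i _; rewrite linearZ.
rewrite qfE Sl rmorph_sum; apply: eq_bigr => i _.
rewrite Sr mulr_sumr rmorph_sum; apply: eq_bigr => j _ /=.
by rewrite mevalZ mevalM !mevalXU; ring.
Qed.

(** The vectors whose first r coordinates vanish do not change the value of qf. *)
Lemma singular_quad_repr r : quad_repr qf r ->
  exists2 Z, singular Z & (m <= r + \dim Z)%N.
Proof.
case=> b [le_rm] [g] [b_basis _ qE].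
have b_free := basis_free b_basis.
pose Z : {vspace V} := <<drop r b>>%VS.
have coordZ y i : y \in Z -> coord b (widen_ord le_rm i) y = 0.
  move=> Zy; rewrite (coord_span (Zy : y \in <<drop_tuple r b>>%VS)) linear_sum.
  apply: big1 => j _; rewrite linearZ /= nth_drop.
  have ltrj : (r + j < m)%N by rewrite -ltn_subRL.
  rewrite (coord_free (Ordinal ltrj) _ b_free) -val_eqE /= gtn_eqF ?mulr0 //.
  by rewrite ltn_addr.
have qD y x : y \in Z -> qf (y + x) = qf x.
  move=> Zy; rewrite !qE; apply: meval_eq => i.
  by rewrite linearD /= coordZ // add0r.
have qZ y : y \in Z -> qf y = 0 by move=> Zy; have := qD y 0 Zy; rewrite addr0 qf0.
exists Z.
  split=> //; apply/subvP => y Zy; apply/radicalP; split=> [|x _]; rewrite ?memvf //.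
  by apply: (addrI (qf x)); rewrite addr0 -[RHS](qD y x Zy) qfD (qZ y) // add0r.
have /eqP -> : free (drop r b).
  by apply: (@catr_free _ _ (take r b)); rewrite cat_take_drop.
by rewrite size_drop size_tuple subnKC.
Qed.

Lemma quad_repr_qrank : quad_repr qf (qrank qf)
  /\ (forall r, quad_repr qf r -> (qrank qf <= r)%N).
Proof.
rewrite /qrank; case: arg_minnP => [|r /asboolP qr minr].
  apply/asboolP; have := @quad_repr_singular 0%VS; rewrite dimv0 subn0; apply.
  by split=> [|x]; rewrite ?sub0v // memv0 => /eqP ->; rewrite qf0.
split=> // k qk; have [lek|ltk] := leqP k m; last first.
  by apply: ltnW; apply: leq_ltn_trans ltk; rewrite -ltnS.
by apply: (minr (Ordinal (lek : (k < m.+1)%N))); apply/asboolP.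
Qed.

(** Only characteristic 2 is at stake. If qf w <> 0 for some w in the radical, any
    element of the radical becomes a zero of qf after adding a multiple of w, as
    every scalar is a square. So the zeros have codimension 1 in the radical, which
    has even codimension because the polar form is alternating; the rank would be
    odd. *)
Lemma qrank_even : ~~ odd (qrank qf) ->
  {in radical, forall x, qf x = 0} /\ (qrank qf + \dim radical = m)%N.
Proof.
move=> even_r; have [/singular_quad_repr[Z [ZR qZ] leZ] minr] := quad_repr_qrank.
have maxZ Y : singular Y -> (qrank qf <= m - \dim Y)%N.
  by move=> /quad_repr_singular /minr.
have dimZ : (qrank qf + \dim Z = m)%N.
  have := maxZ Z (conj ZR qZ); have : (\dim Z <= m)%N by rewrite dimvS ?subvf.
  by lia.
have qR0 : {in radical, forall x, qf x = 0}.
  move=> w Rw; apply/eqP/negPn/negP => qw.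
  have radE x y : x \in radical -> qf (x + y) = qf x + qf y.
    by case/radicalP=> _ xR; rewrite qfD xR ?addr0 ?memvf.
  have two0 : 2%:R = 0 :> F.
    apply: (mulIf qw); rewrite -polarxx mul0r.
    by case/radicalP: Rw => _ ->; rewrite ?memvf.
  have sqr_inj : injective (fun a : F => a ^+ 2).
    move=> a b /= eq_ab; apply/eqP; rewrite -subr_eq0 -sqrf_eq0.
    rewrite (_ : _ ^+ 2 = a ^+ 2 - b ^+ 2 + 2%:R * (b ^+ 2 - a * b)); last by ring.
    by rewrite eq_ab subrr two0 mul0r addr0.
  have RZw : (radical <= Z + <[w]>)%VS.
    apply/subvP => y Ry; pose a := invF sqr_inj (- qf y / qf w).
    have aE : a ^+ 2 * qf w = - qf y by rewrite (f_invF sqr_inj) divfK.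
    pose z := y + a *: w.
    have Rz : z \in radical by rewrite rpredD ?rpredZ.
    have qz : qf z = 0 by rewrite radE // qfZ aE subrr.
    have Zz : z \in Z.
      have singZz : singular (Z + <[z]>)%VS.
        split=> [|_ /memv_addP[t Zt [_ /vlineP[c ->] ->]]].
          by rewrite subv_add ZR -memvE.
        by rewrite radE ?(subvP ZR) // qfZ qz mulr0 addr0 qZ.
      have le1 := maxZ _ singZz.
      have le2 : (\dim (Z + <[z]>) <= m)%N by rewrite dimvS ?subvf.
      have /eqP -> : Z == (Z + <[z]>)%VS
        by rewrite eqEdim addvSl /= -(leq_add2l (qrank qf)) dimZ addnC -leq_subRL.
      by rewrite (subvP (addvSr _ _)) ?memv_line.
    by rewrite -[y](addrK (a *: w)) memv_add // rpredN rpredZ ?memv_line.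
  have dimR : \dim radical = (\dim Z).+1.
    have -> : radical = (Z + <[w]>)%VS.
      by apply/eqP; rewrite eqEsubv RZw subv_add ZR -memvE.
    rewrite dimv_disjoint_sum ?dim_vline.
      have w0 : w != 0 by apply: contraNneq qw => ->; rewrite qf0.
      by rewrite w0 addn1.
    apply/eqP; rewrite -subv0; apply/subvP => x /memv_capP[Zx /vlineP[c xE]].
    move: (qZ x Zx); rewrite memv0 xE qfZ => /eqP.
    by rewrite mulf_eq0 (negbTE qw) orbF sqrf_eq0 => /eqP ->; rewrite scale0r.
  have alt : {in (fullv : {vspace V}), forall x, polar x x = 0}.
    by move=> x _; rewrite polarxx two0 mul0r.
  have := dimvS (radicalS S fullv); have := alternating_codim_even alt.
  rewrite dimR -[X in (X - _)%N]dimZ -[X in (_ <= X)%N]dimZ subnS addnK.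
  by case: (qrank qf : nat) even_r => [|n] /=; [rewrite ltnn | move=> /negbTE->].
split=> //; apply/eqP; rewrite eqn_leq -[X in (X <= qrank qf + _)%N]dimZ leq_add2l (dimvS ZR) andbT.
by rewrite addnC -leq_subRL ?dimvS ?subvf ?maxZ.
Qed.

End QuadraticRank.

(** * The trace pairing *)
Section Trace.

Variables (F : finFieldType) (K : fieldExtType F).
Local Notation V := (finvect_type K).
Local Notation m := (\dim {:K}).
Local Notation q := #|F|.

Lemma card_ext : #|V| = (q ^ m)%N.
Proof. by rewrite -(card_vspace {:V}) card_vspacef. Qed.

Fact Tr_linear : linear (@Tr F K : V -> F^o).
Proof.
move=> a x y; have one_neq0 : (1 : V) != 0 by apply: oner_neq0.
have alg_inj : injective (fun c : F => c%:A : V).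
  move=> c d /eqP; rewrite -subr_eq0 -scalerBl scaler_eq0 (negbTE one_neq0).
  by rewrite orbF subr_eq0 => /eqP.
apply: alg_inj; rewrite /= TrE scalerDl -scalerA !TrE /galTrace scaler_sumr -big_split.
by apply: eq_bigr => g _; rewrite linearP.
Qed.

HB.instance Definition _ := GRing.isLinear.Build F V F^o _ (@Tr F K) Tr_linear.

Lemma TrD (x y : V) : Tr (x + y) = Tr x + Tr y.
Proof. exact: linearD. Qed.

Lemma TrZ a (x : V) : Tr (a *: x) = a * Tr x.
Proof. exact: linearZ. Qed.

Lemma Tr0 : Tr (0 : V) = 0.
Proof. exact: linear0. Qed.

Lemma TrB (x y : V) : Tr (x - y) = Tr x - Tr y.
Proof. exact: linearB. Qed.

Lemma Tr_eqP (x y : V) : (Tr x == Tr y) = (galTrace 1 {:V} x == galTrace 1 {:V} y).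
Proof.
rewrite -!TrE -[RHS]subr_eq0 -scalerBl scaler_eq0 subr_eq0.
by rewrite (negbTE (oner_neq0 V)) orbF.
Qed.

Lemma Tr_nondegenerate (c : V) : c != 0 -> exists y, Tr (c * y) != 0.
Proof.
move=> c0; have [y _ ny] := @gal_independent_contra _ V fullv
  (fun g => g \in 'Gal({:V} / 1)%g) (fun=> 1) 1%g (group1 _) (oner_neq0 _).
exists (c^-1 * y); rewrite mulVKf // -(linear0 (@Tr F K)) Tr_eqP.
rewrite raddf0 /galTrace; congr (_ != 0): ny.
by apply: eq_bigr => g _; rewrite mul1r.
Qed.

Lemma frobenius_gal : exists2 g : gal_of {:V}, g \in 'Gal({:V} / 1)%g
  & forall x, g x = x ^+ q.
Proof.
have [g /eqP gG gE] := finField_galois_generator (sub1v {:V}).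
exists g => [|x]; first by rewrite gG cycle_id.
by rewrite gE ?memvf // dimv1 expn1.
Qed.

Lemma frobenius_linear (l : nat) (a : F) (x y : V) :
  (a *: x + y) ^+ (q ^ l) = a *: x ^+ (q ^ l) + y ^+ (q ^ l).
Proof.
have [g _ gE] := frobenius_gal.
elim: l => [|l IHl]; first by rewrite !expr1.
by rewrite expnSr !exprM IHl -!gE linearP.
Qed.

Lemma Tr_frobenius (l : nat) (x : V) : Tr (x ^+ (q ^ l)) = Tr x.
Proof.
have [g gG gE] := frobenius_gal.
elim: l => [|l IHl]; first by rewrite expr1.
rewrite -[RHS]IHl expnSr exprM; apply/eqP.
by rewrite Tr_eqP -gE galTrace_gal ?memvf.
Qed.

Lemma frobenius_period (x : V) : x ^+ (q ^ m) = x.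
Proof. by rewrite -card_ext expf_card. Qed.

(** Apply the automorphism x ^ (q ^ (m - l)), which leaves the trace unchanged and
    turns y ^ (q ^ l) back into y. *)
Lemma Tr_adjoint (l : nat) (a x y : V) : (l <= m)%N ->
  Tr (x * (a * y ^+ (q ^ l))) = Tr ((a * x) ^+ (q ^ (m - l)) * y).
Proof.
move=> le_lm; rewrite -(Tr_frobenius (m - l)) mulrCA mulrA exprMn -exprM -expnD.
by rewrite subnKC // frobenius_period.
Qed.

Definition trace_mul (c : V) (x : V) : F^o := Tr (c * x).
Fact trace_mul_linear c : linear (trace_mul c).
Proof. by move=> a x y; rewrite /trace_mul mulrDr -scalerAr linearP. Qed.
HB.instance Definition _ c :=
  GRing.isLinear.Build F V F^o _ (trace_mul c) (trace_mul_linear c).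

Definition trace_lfun c : 'Hom(V, F^o) := linfun (trace_mul c).

Lemma trace_lfunE c x : trace_lfun c x = Tr (c * x).
Proof. by rewrite lfunE. Qed.

Fact trace_lfun_linear : linear trace_lfun.
Proof.
move=> a c d; apply/lfunP => x; rewrite add_lfunE scale_lfunE !trace_lfunE.
by rewrite mulrDl -scalerAl linearP.
Qed.
HB.instance Definition _ :=
  GRing.isLinear.Build F V 'Hom(V, F^o) _ trace_lfun trace_lfun_linear.

Definition trace_form_fun (A : 'End(V)) (x : V) : 'Hom(V, F^o) :=
  (trace_lfun x \o A)%VF.

Fact trace_form_fun_linear A : linear (trace_form_fun A).
Proof.
by move=> a x y; rewrite /trace_form_fun linearP comp_lfunDl comp_lfunZl.
Qed.
HB.instance Definition _ A := GRing.isLinear.Build F V 'Hom(V, F^o) _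
  (trace_form_fun A) (trace_form_fun_linear A).

Definition trace_form (A : 'End(V)) : 'Hom(V, 'Hom(V, F^o)) :=
  linfun (trace_form_fun A).

Lemma trace_formE A x y : trace_form A x y = Tr (x * A y).
Proof. by rewrite lfunE /= comp_lfunE trace_lfunE. Qed.

Definition trace_perp (W : {vspace V}) : {set V} :=
  [set b | [forall w : V, (w \in W) ==> (Tr (b * w) == 0)]].

Lemma trace_perpP (W : {vspace V}) b :
  reflect {in W, forall w, Tr (b * w) = 0} (b \in trace_perp W).
Proof.
rewrite inE; apply: (iffP forallP) => [h w Ww | h w].
  by apply/eqP; have /implyP := h w; apply.
by apply/implyP => /h ->.
Qed.

(** Count the pairs (b, w) with Tr (b * w) = 0 in two ways, using that a nonzero
    functional vanishes on a fraction 1/q of the points. *)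
Lemma card_trace_perp (W : {vspace V}) : (#|trace_perp W| * #|W| = #|V|)%N.
Proof.
have q_gt1 := finNzRing_gt1 F.
pose Z (b w : V) := Tr (b * w) == 0.
have byW : (q * \sum_(w in W) #|[set b | Z b w]| = q.-1 * #|V| + #|V| * #|W|)%N.
  rewrite (bigD1 0) ?mem0v //= mulnDr big_distrr /=.
  have -> : [set b | Z b 0] = [set: V].
    by apply/setP => b; rewrite !inE /Z mulr0 linear0 eqxx.
  rewrite (eq_bigr (fun=> #|V|)) => [|w /andP[_ w0]]; last first.
    have [u wu] := Tr_nondegenerate w0.
    have := @card_lfun_fiber F K fullv (trace_lfun w) u 0 (memvf u).
    rewrite trace_lfunE card_vspacef => /(_ wu) <-; congr (_ * _)%N.
    by apply: eq_card => b; rewrite !inE memvf trace_lfunE /Z mulrC.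
  have W_gt0 : (0 < #|W|)%N by apply/card_gt0P; exists 0; apply: mem0v.
  rewrite cardsT sum_nat_const [X in (_ + X * _)%N](_ : _ = #|W|.-1); last first.
    by rewrite [in RHS](cardD1 0) mem0v; apply: eq_card => w; rewrite !inE andbC.
  rewrite -[#|W| in RHS](prednK W_gt0) -[X in (X * _ + _ = _)%N](prednK (ltnW q_gt1)).
  by rewrite /=; ring.
have byV : (q * \sum_(b : V) #|[set w in W | Z b w]|
    = q.-1 * (#|trace_perp W| * #|W|) + #|V| * #|W|)%N.
  rewrite big_distrr /=.
  transitivity (\sum_(b : V) (#|W| + (b \in trace_perp W) * (q.-1 * #|W|)))%N.
    apply: eq_bigr => b _; have [bW | nbW] := boolP (b \in trace_perp W).
      rewrite mul1n -mulSn prednK ?(ltnW q_gt1) //; congr (_ * _)%N.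
      rewrite -[RHS]cardsE; apply: eq_card => w; rewrite !inE.
      by have [Ww|//] := boolP (w \in W); rewrite /Z (trace_perpP _ _ bW) ?eqxx.
    have [w Ww bw] : exists2 w, w \in W & trace_lfun b w != 0.
      move: nbW; apply: contraNP => /forall2NP nW; apply/trace_perpP => w Ww.
      by rewrite -trace_lfunE; have [//|/negP/negPn/eqP] := nW w.
    rewrite addn0 -(card_lfun_fiber 0 Ww bw); congr (_ * _)%N.
    by apply: eq_card => x; rewrite !inE trace_lfunE.
  have card_perp : (\sum_(b : V) (b \in trace_perp W) = #|trace_perp W|)%N.
    rewrite -sum1_card [RHS]big_mkcond; apply: eq_bigr => b _.
    by case: (b \in trace_perp W).
  rewrite big_split /= sum_nat_const -big_distrl /= card_perp.
  by ring.
apply/eqP; rewrite -(eqn_pmul2l (_ : 0 < q.-1)%N); last by rewrite -subn1 subn_gt0.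
rewrite -(eqn_add2r (#|V| * #|W|)%N) -byV -byW; apply/eqP; congr (_ * _)%N.
under [RHS]eq_bigr => w Ww do rewrite -sum1_card.
rewrite (exchange_big_dep xpredT) //=; apply: eq_bigr => b _.
by rewrite -sum1_card; apply: eq_bigl => w; rewrite !inE.
Qed.

End Trace.

(** * Zeros of a quadratic form plus an affine function *)
Section ShiftedForms.

Variables (F : finFieldType) (K : fieldExtType F).
Local Notation V := (finvect_type K).
Local Notation m := (\dim {:K}).
Local Notation q := #|F|.

Variables (S : 'Hom(V, 'Hom(V, F^o))) (P : V -> V).
Hypothesis polarP : forall x y, polar S x y = Tr (P x * y).
Local Notation qf := (qf S).
Local Notation radical := (radical S fullv).

Definition zeros (b : V) (c : F) : nat := #|[set x : V | qf x + Tr (b * x) + c == 0]|.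

Lemma radical_fiber x y : (P x == P y) = (x - y \in radical).
Proof.
apply/eqP/radicalP => [eqP_xy | [_ Rxy]].
  split=> [|z _]; first exact: memvf.
  by rewrite -scaleN1r polarDl polarZl mulN1r !polarP eqP_xy subrr.
apply/eqP; rewrite -subr_eq0; apply/negPn/negP => /Tr_nondegenerate[z /negP[]].
rewrite mulrBl TrB -!polarP -mulN1r -polarZl -polarDl scaleN1r.
by rewrite Rxy ?memvf.
Qed.

(** The fibres of P are the cosets of the radical. *)
Lemma card_polar_image (H : pred V) :
  (#|[set b in P @: setT | H b]| * #|radical| = #|[set x | H (P x)]|)%N.
Proof.
rewrite -[RHS]sum1_card (partition_big P (mem [set b in P @: setT | H b])) /=; last first.
  by move=> x; rewrite !inE => ->; rewrite imset_f ?inE.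
rewrite -sum_nat_const; apply: eq_bigr => b; rewrite inE => /andP[/imsetP[x _ ->] Hx].
rewrite sum1_card -(card_imset (mem radical) (addrI x)).
apply: eq_card => y; rewrite [RHS]unfold_in /= inE.
apply/imsetP/idP => [[z Rz ->]|].
  have Pz : P (x + z) == P x by rewrite radical_fiber addrAC subrr add0r.
  by rewrite (eqP Pz) Hx eqxx.
rewrite radical_fiber => /andP[_ Ryx].
by exists (y - x); rewrite // addrC subrK.
Qed.

(** The image is orthogonal to the radical by symmetry of the polar form, and both
    sets have #|V| / #|radical| elements. *)
Lemma polar_image : P @: setT = trace_perp radical.
Proof.
have radical_gt0 : (0 < #|radical|)%N by apply/card_gt0P; exists 0; apply: mem0v.
apply/eqP; rewrite eqEcard; apply/andP; split.
  apply/subsetP => _ /imsetP[x _ ->]; apply/trace_perpP => w /radicalP[_ Rw].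
  by rewrite -polarP polarC Rw ?memvf.
rewrite -(leq_pmul2r radical_gt0) card_trace_perp.
have /= := card_polar_image xpredT.
rewrite (_ : [set b in _ | _] = P @: setT); last by apply/setP => b; rewrite inE andbT.
by move->; rewrite -cardsT; apply: eq_leq; apply: eq_card => x; rewrite !inE.
Qed.

(** By duality Tr (b * w) <> 0 for some w in the radical, and moving along w
    changes the function by multiples of this scalar. *)
Lemma zeros_balanced b c : {in radical, forall x, qf x = 0} ->
  b \notin P @: setT -> (q * zeros b c = #|V|)%N.
Proof.
move=> qR0; rewrite polar_image => nRb.
have [w Rw bw] : exists2 w, w \in radical & Tr (b * w) != 0.
  move: nRb; apply: contraNP => /forall2NP nR; apply/trace_perpP => w Rw.
  by have [//|/negP/negPn/eqP] := nR w.
have := @card_shift_fiber F K setT (fun x => qf x + Tr (b * x) + c)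
  (fun=> Tr (b * w)) w 0; rewrite cardsT => <-;
  [by congr (_ * _)%N; apply: eq_card => x; rewrite !inE | by [] | ].
move=> x a _.
rewrite inE; split=> //; case/radicalP: (Rw) => _ wR.
rewrite (addrC x) qfD qfZ polarZl qR0 // wR ?memvf // !mulr0 addr0 add0r.
rewrite mulrDr -scalerAr TrD TrZ.
by ring.
Qed.

(** Completing the square: polar x0 x = Tr (P x0 * x). *)
Lemma zeros_image x0 c : zeros (P x0) c = level S fullv (qf x0 - c).
Proof.
rewrite /zeros /level -[RHS](card_imset _ (addrI (- x0))).
apply: eq_card => x; rewrite inE; apply/idP/imsetP => [zx | [y]].
  exists (x0 + x); last by rewrite addrA addNr add0r.
  rewrite inE memvf qfD polarP -subr_eq0.
  rewrite (_ : _ - _ = qf x + Tr (P x0 * x) + c) //; ring.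
rewrite inE memvf => /= /eqP qy xE; have yE : y = x0 + x by rewrite xE addrA subrr add0r.
move: qy; rewrite yE qfD polarP => qy.
rewrite (_ : _ + c = qf x0 + qf x + Tr (P x0 * x) - (qf x0 - c)); last by ring.
by rewrite qy subrr.
Qed.

End ShiftedForms.

(** * Frequencies contributed by one form *)
Section FormFrequencies.

Variables (F : finFieldType) (K : fieldExtType F).
Local Notation V := (finvect_type K).
Local Notation m := (\dim {:K}).
Local Notation q := #|F|.
Local Notation Q := (q%:R : rat).
Local Notation W := (Q ^ m%:Z - Q ^ (m%:Z - 1)).
Local Notation sg k := ((-1) ^+ k : rat).
Local Notation wexp r := (m%:Z - r./2%:Z - 1).

(** The part of the two rows of index (r, i) that falls on weight w, for a single
    form of rank r and type i = 1 or i = 2 (the latter being type 3); unit_row1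
    belongs to constant term 0 and unit_row2 to the nonzero constant terms. *)
Definition unit_row1 (r i : nat) (w : rat) : rat :=
  (W + sg i * (Q - 1) * Q ^ wexp r == w)%:R
    * (Q ^ (r%:Z - 1) + sg i.+1 * (Q - 1) * Q ^ (r./2%:Z - 1))
  + (W + sg i.+1 * Q ^ wexp r == w)%:R
    * ((Q ^ (r%:Z - 1) + sg i * Q ^ (r./2%:Z - 1)) * (Q - 1)).

Definition unit_row2 (r i : nat) (w : rat) : rat :=
  (W - 1 + sg i * (Q - 1) * Q ^ wexp r == w)%:R
    * ((Q ^ (r%:Z - 1) + sg i * Q ^ (r./2%:Z - 1)) * (Q - 1))
  + (W - 1 + sg i.+1 * Q ^ wexp r == w)%:R
    * ((Q ^ r%:Z - Q ^ (r%:Z - 1) + sg i.+1 * Q ^ (r./2%:Z - 1)) * (Q - 1)).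

Variables (S : 'Hom(V, 'Hom(V, F^o))) (P : V -> V).
Hypothesis polarP : forall x y, polar S x y = Tr (P x * y).
Local Notation qf := (qf S).
Local Notation radical := (radical S fullv).
Local Notation level := (level S fullv).
Local Notation r := (qrank qf : nat).
Hypothesis even_r : ~~ odd (qrank qf).

Let q_gt1 : 1 < Q.
Proof. by rewrite ltr1n finNzRing_gt1. Qed.

Let Q_neq0 : Q != 0.
Proof. by rewrite gt_eqF // (lt_trans ltr01). Qed.

Let k : nat := (qrank qf)./2.
Let d : nat := \dim radical.
Let y : rat := Q ^+ k.
Let u : rat := Q ^+ d.

Let r_double : r = k.*2.
Proof. by rewrite -[LHS]odd_double_half (negbTE even_r). Qed.

Let mE : m = (d + k.*2)%N.
Proof. by have [_ <-] := qrank_even even_r; rewrite addnC r_double. Qed.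

Let expz1 (n : nat) : Q ^ (n%:Z - 1) = Q ^+ n / Q.
Proof. by rewrite expfzDr // exprN1. Qed.

(* Everything is expressed in y = q ^ (r / 2) and u = #|radical|, so that
   identities between powers of q become identities of rational functions. *)
Let powers : (Q ^ m%:Z = u * y ^+ 2) * (Q ^ (m%:Z - 1) = u * y ^+ 2 / Q)
  * (Q ^ (m%:Z - k%:Z - 1) = u * y / Q) * (Q ^ r%:Z = y ^+ 2)
  * (Q ^ (r%:Z - 1) = y ^+ 2 / Q) * (Q ^ (k%:Z - 1) = y / Q).
Proof.
have mQ : Q ^+ m = u * y ^+ 2 by rewrite mE exprD -exprM muln2.
have rQ : Q ^+ r = y ^+ 2 by rewrite r_double -exprM muln2.
do !split; rewrite ?expz1 -?exprnP ?mQ ?rQ //.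
rewrite (_ : m%:Z - k%:Z = (d + k)%N%:Z) ?expz1 ?exprD //.
by rewrite mE -addnn addnA PoszD addrK.
Qed.

Let u_neq0 : u != 0. Proof. by rewrite expf_neq0. Qed.

Lemma level_qrank : exists e : bool, forall c, (level c)%:R
  = Q ^ (m%:Z - 1) + sg e * (Q * (c == 0)%:R - 1) * Q ^ wexp r :> rat.
Proof.
have [qR0 _] := qrank_even even_r.
have dimV : \dim (fullv : {vspace V}) = (\dim radical + k.*2)%N by exact: mE.
have [e eE] := level_distribution qR0 dimV.
exists e => c; apply: (mulfI Q_neq0); rewrite eE card_vspacef card_ext natrX.
rewrite exprnP -/k !powers exprD -/u -/y.
by field.
Qed.

Section Signed.

Variable e : bool.
Hypothesis levelE : forall c, (level c)%:R
  = Q ^ (m%:Z - 1) + sg e * (Q * (c == 0)%:R - 1) * Q ^ wexp r :> rat.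

Lemma has_sign_level (e' : bool) : has_sign qf (sg e') = (e == e').
Proof.
rewrite /has_sign even_r /=.
rewrite (_ : #|_| = level 0); last by apply: eq_card => x; rewrite !inE memvf.
rewrite levelE eqxx mulr1 (inj_eq (addrI _)) -/k !powers.
have uy0 : u * y / Q != 0 by rewrite !mulf_neq0 ?invr_neq0 ?expf_neq0.
have Q1 : Q - 1 != 0 by rewrite subr_eq0 gt_eqF.
rewrite (inj_eq (mulIf uy0)) (inj_eq (mulIf Q1)).
by case: e e' => [] [].
Qed.

(** The b outside the image of P all give weight W. For b = P x0 the zeros form
    the level of qf x0 - c, which depends only on whether qf x0 = c; the division
    by u accounts for the fibres of P. *)
Lemma card_zeros_eq (c : F) (w : rat) :
  #|[set b | Q ^ m%:Z - (zeros S b c)%:R == w]|%:R =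
    (W == w)%:R * (Q ^ m%:Z - Q ^ r%:Z)
    + (Q ^ m%:Z - (level 0)%:R == w)%:R * ((level c)%:R / u)
    + (Q ^ m%:Z - (level 1)%:R == w)%:R * ((Q ^ m%:Z - (level c)%:R) / u) :> rat.
Proof.
have [qR0 _] := qrank_even even_r.
have cardV : #|V|%:R = Q ^ m%:Z :> rat by rewrite card_ext natrX.
have cardR : #|radical|%:R = u by rewrite card_vspace natrX.
pose H b := Q ^ m%:Z - (zeros S b c)%:R == w.
have inE_H : #|[set b in P @: setT | H b]|%:R
    = (Q ^ m%:Z - (level 0)%:R == w)%:R * ((level c)%:R / u)
    + (Q ^ m%:Z - (level 1)%:R == w)%:R * ((Q ^ m%:Z - (level c)%:R) / u).
  apply: (mulIf u_neq0); rewrite -{1}cardR -natrM (card_polar_image polarP).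
  have HE x : H (P x) = if qf x == c then Q ^ m%:Z - (level 0)%:R == w
                        else Q ^ m%:Z - (level 1)%:R == w.
    rewrite /H (zeros_image polarP); have [qc|qc] := eqVneq (qf x) c.
      by rewrite qc subrr.
    by rewrite !levelE subr_eq0 (negbTE qc) oner_eq0.
  have levelC : #|[set x | qf x != c]|%:R = Q ^ m%:Z - (level c)%:R.
    have -> : level c = #|[set x | qf x == c]|.
      by apply: eq_card => x; rewrite !inE memvf.
    rewrite -cardV -(cardsC [set x : V | qf x == c]) natrD [X in X - _]addrC addrK.
    by congr _%:R; apply: eq_card => x; rewrite !inE.
  rewrite -(cardsID [set x | qf x == c]) natrD mulrDl -!mulrA mulVf // !mulr1.
  congr (_ + _).
    rewrite /level; case: eqP => Hw; rewrite ?mul1r ?mul0r; last first.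
      apply/eqP; rewrite pnatr_eq0 cards_eq0; apply/eqP/setP => x; rewrite !inE HE.
      by case: ifP => _; rewrite ?andbF ?andbT //; apply/eqP.
    congr _%:R; apply: eq_card => x; rewrite !inE HE memvf.
    by case: ifP => _; rewrite ?andbF ?andbT //; apply/eqP.
  rewrite -levelC; case: eqP => Hw; rewrite ?mul1r ?mul0r; last first.
    apply/eqP; rewrite pnatr_eq0 cards_eq0; apply/eqP/setP => x; rewrite !inE HE.
    by case: ifP => _; rewrite ?andbF ?andbT //=; apply/eqP.
  congr _%:R; apply: eq_card => x; rewrite !inE HE.
  by case: ifP => _; rewrite ?andbF ?andbT //=; apply/eqP.
have notin_H : #|[set b in ~: (P @: setT) | H b]|%:R
    = (W == w)%:R * (Q ^ m%:Z - Q ^ r%:Z).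
  have zE b : b \in ~: (P @: setT) -> H b = (W == w).
    rewrite inE /H => /(zeros_balanced polarP c qR0) zE.
    congr (_ - _ == _); apply: (mulfI Q_neq0).
    by rewrite -natrM zE cardV !powers; field.
  have cardC : #|~: (P @: setT)|%:R = Q ^ m%:Z - Q ^ r%:Z.
    have imE : #|P @: setT|%:R = Q ^ r%:Z.
      apply: (mulIf u_neq0); rewrite -{1}cardR -natrM.
      have := card_polar_image polarP xpredT.
      rewrite (_ : [set b in _ | _] = P @: setT); last first.
        by apply/setP => b; rewrite inE andbT.
      move=> ->; rewrite (_ : #|_| = #|V|); last by apply: eq_card => x; rewrite !inE.
      by rewrite cardV !powers mulrC.
    by rewrite -cardV -(cardsC (P @: setT)) natrD imE addrAC subrr add0r.
  rewrite -cardC; case: eqP zE => Ww zE; rewrite ?mul1r ?mul0r.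
    by congr _%:R; apply: eq_card => b; rewrite [LHS]inE; case: (boolP (b \in ~: _)) => [/zE->|].
  apply/eqP; rewrite pnatr_eq0 cards_eq0; apply/eqP/setP => b; rewrite [LHS]inE in_set0.
  by case: (boolP (b \in ~: _)) => [/zE->|].
rewrite -addrA -inE_H -notin_H addrC -natrD -(cardsID (P @: setT)).
by congr (_ + _)%:R; apply: eq_card => b; rewrite !inE andbC.
Qed.

Lemma card_zeros_linear w :
  #|[set b | Q ^ m%:Z - (zeros S b 0)%:R == w]|%:R =
    (W == w)%:R * (Q ^ m%:Z - Q ^ r%:Z) + unit_row1 r e.+1 w.
Proof.
rewrite card_zeros_eq -addrA; congr (_ + _); rewrite /unit_row1 !levelE.
rewrite !eqxx !oner_eq0 -/k !powers !exprS; congr (_ * _ + _ * _).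
- congr ((_ == _)%:R); case: (e) => /=; rewrite ?expr1 ?expr0; ring.
- case: (e) => /=; rewrite ?expr1 ?expr0; field; rewrite Q_neq0 //=.
- congr ((_ == _)%:R); case: (e) => /=; rewrite ?expr1 ?expr0; ring.
- case: (e) => /=; rewrite ?expr1 ?expr0; field; rewrite Q_neq0 //=.
Qed.

(** Subtracting 1 discards the point 0, at which the function has value c <> 0. *)
Lemma card_zeros_affine w :
  \sum_(c : F | c != 0) #|[set b | Q ^ m%:Z - (zeros S b c)%:R - 1 == w]|%:R =
    (W - 1 == w)%:R * ((Q - 1) * (Q ^ m%:Z - Q ^ r%:Z)) + unit_row2 r e.+1 w.
Proof.
have eq_shift a : (a - 1 == w) = (a == w + 1) by rewrite subr_eq.
rewrite /unit_row2; pose X := #|[set b | Q ^ m%:Z - (zeros S b 1)%:R == w + 1]|%:R : rat.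
transitivity ((Q - 1) * X).
  rewrite -[Q - 1]sum1_nonzero mulr_suml; apply: eq_bigr => c c0; rewrite mul1r /X.
  transitivity (#|[set b | Q ^ m%:Z - (zeros S b c)%:R == w + 1]|%:R : rat).
    by congr _%:R; apply: eq_card => b; rewrite !inE eq_shift.
  by rewrite !card_zeros_eq !levelE (negbTE c0) oner_eq0.
rewrite /X card_zeros_eq 2!mulrDr -addrA mulrCA eq_shift; congr (_ + _).
rewrite !levelE !eqxx !oner_eq0 -/k !powers !exprS !(mulrCA (Q - 1)).
congr (_ * _ + _ * _).
- rewrite -eq_shift; congr ((_ == _)%:R); case: (e) => /=; rewrite ?expr1 ?expr0; ring.
- case: (e) => /=; rewrite ?expr1 ?expr0; field; rewrite Q_neq0 //=.
- rewrite -eq_shift; congr ((_ == _)%:R); case: (e) => /=; rewrite ?expr1 ?expr0; ring.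
- case: (e) => /=; rewrite ?expr1 ?expr0; field; rewrite Q_neq0 //=.
Qed.

End Signed.

(** For rank at least 2 the number of zeros misses q ^ m by at least
    q ^ (m - 2) * (q - 1) ^ 2, which exceeds 1 once m > 2. *)
Lemma zeros_lt b c : (2 < m)%N -> (0 < r)%N ->
  1 < Q ^ m%:Z - (zeros S b c)%:R.
Proof.
move=> m_gt2 rank_gt0; have q_gt1' : (1 < q)%N := finNzRing_gt1 F.
pose t := Q ^+ (m - 2).
have Q_ge2 : 2 <= Q by rewrite ler_nat.
have t_ge2 : 2 <= t.
  apply: le_trans Q_ge2 _; rewrite -[X in X <= _]expr1 ler_weXn2l ?ler1n ?(ltnW q_gt1') //.
  by rewrite subn_gt0.
have pow_mE : Q ^ m%:Z = t * Q ^+ 2 by rewrite /t -exprD subnK // ltnW.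
have pow_pred_mE : Q ^ (m%:Z - 1) = t * Q.
  by rewrite expfzDr // pow_mE exprN1; field.
have [bP|nbP] := boolP (b \in P @: setT); last first.
  have /(congr1 (fun n => n%:R : rat)) := zeros_balanced polarP c (qrank_even even_r).1 nbP.
  rewrite natrM card_ext natrX exprnP pow_mE expr2 mulrCA => /(mulfI Q_neq0) ->.
  have -> : Q * (t * Q) - t * Q = (t - 2) * Q * (Q - 1) + 2 * Q * (Q - 1) by ring.
  have ge0 : 0 <= (t - 2) * Q * (Q - 1) by rewrite !mulr_ge0 //; lra.
  by nra.
have [e levelE] := level_qrank.
case/imsetP: bP => x _ ->; rewrite (zeros_image polarP) levelE pow_mE pow_pred_mE.
set v := Q ^ _; have v_ge0 : 0 <= v by rewrite exprz_ge0 ?ler0n.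
have v_le : v <= t.
  rewrite /v /t exprnP ler_weXz2l ?ler1n ?(ltnW q_gt1') //.
  have : (1 <= (qrank qf)./2)%N by move: even_r rank_gt0; lia.
  by lia.
have sgE : sg e * (Q * (qf x - c == 0)%:R - 1) * v <= (Q - 1) * v.
  apply: ler_wpM2r => //; case: (e); case: (_ == 0) => /=; rewrite ?expr1 ?expr0; lra.
have sg_le : (Q - 1) * v <= (Q - 1) * t by rewrite ler_wpM2l //; lra.
have tQ : t * Q ^+ 2 - t * Q - (Q - 1) * t = t + t * Q * (Q - 2) by ring.
have : 0 <= t * Q * (Q - 2) by rewrite !mulr_ge0 //; lra.
by lra.
Qed.


End FormFrequencies.

(** * The forms of the family *)
Section FrobeniusPolynomials.

Variables (F : finFieldType) (K : fieldExtType F) (s : nat) (ell : s.-tuple nat).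
Local Notation V := (finvect_type K).
Local Notation m := (\dim {:K}).
Local Notation q := #|F|.
Local Notation polyK := {poly_(#|F| ^ \dim {:K}) (finvect_type K)}.
Local Notation l_ i := (tnth ell i).
Local Notation L := (span_mono K ell).

Hypothesis ell_small : forall l : nat, l \in ell -> (2 * l < m)%N.

Let ltlm i : (2 * l_ i < m)%N.
Proof. by apply: ell_small; apply: mem_tnth. Qed.

Let lelm i : (l_ i <= m)%N.
Proof. by have := ltlm i; lia. Qed.

Let lt_l i : (l_ i < m)%N.
Proof. by have := ltlm i; lia. Qed.

Let q_gt1 : (1 < q)%N.
Proof. exact: finNzRing_gt1. Qed.

Lemma frob_exp_size l : (2 * l < m)%N -> (q ^ l < q ^ m)%N.
Proof. by move=> ?; rewrite ltn_exp2l //; lia. Qed.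

Definition frob_poly (c : 'I_s -> V) : polyK :=
  \sum_i c i *: npolyp (q ^ m) 'X^(q ^ l_ i).

Lemma span_monoP R : reflect (exists c, R = frob_poly c) (R \in L).
Proof.
pose X := map_tuple (fun l => npolyp (q ^ m) 'X^(q ^ l) : polyK) ell.
have XE i : X`_i = (if (i < s)%N then npolyp (q ^ m) 'X^(q ^ nth 0%N ell i) else 0) :> polyK.
  case: ltnP => [lt_is|le_si]; first by rewrite (nth_map 0%N) ?size_tuple.
  by rewrite nth_default ?size_tuple.
apply: (iffP idP) => [LR | [c ->]].
  exists (fun i => coord X i R); rewrite {1}(coord_span (LR : R \in <<X>>%VS)).
  by apply: eq_bigr => i _; rewrite XE ltn_ord (tnth_nth 0%N).
apply: rpred_sum => i _; apply: rpredZ; apply: memv_span.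
by apply/mapP; exists (l_ i); rewrite ?mem_tnth.
Qed.

Lemma frob_polyE c : frob_poly c = \sum_i c i *: 'X^(q ^ l_ i) :> {poly V}.
Proof.
rewrite /frob_poly raddf_sum; apply: eq_bigr => i _ /=.
transitivity (c i *: (npolyp (q ^ m) 'X^(q ^ l_ i) : {poly V})) => //.
by rewrite npolypK // size_polyXn frob_exp_size.
Qed.

Lemma frob_poly_horner c x :
  (frob_poly c : {poly V}).[x] = \sum_i c i * x ^+ (q ^ l_ i).
Proof.
rewrite frob_polyE horner_sum; apply: eq_bigr => i _.
by rewrite hornerZ hornerXn.
Qed.

Let expq_inj : injective (expn q).
Proof. by move=> a b /eqP; rewrite eqn_exp2l // => /eqP. Qed.

Hypothesis ell_uniq : uniq ell.

Let tnth_ell_eq i j : (q ^ l_ i == q ^ l_ j)%N = (i == j).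
Proof.
by rewrite (inj_eq expq_inj) !(tnth_nth 0%N) nth_uniq ?size_tuple.
Qed.

Lemma frob_poly_inj c d : frob_poly c = frob_poly d -> c =1 d.
Proof.
move=> cd j.
have coefE e : (frob_poly e : {poly V})`_(q ^ l_ j) = e j.
  rewrite frob_polyE coef_sum (bigD1 j) //= coefZ coefXn eqxx mulr1 big1 ?addr0 //.
  by move=> i ij; rewrite coefZ coefXn tnth_ell_eq eq_sym (negbTE ij) mulr0.
by rewrite -coefE cd coefE.
Qed.

Lemma dim_span_mono : \dim L = s.
Proof.
pose X := map_tuple (fun l => npolyp (q ^ m) 'X^(q ^ l) : polyK) ell.
suffices /eqP : free X by rewrite size_tuple.
apply/freeP => c c0 i.
have /frob_poly_inj -> // : frob_poly c = frob_poly (fun=> 0).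
rewrite [RHS]big1 => [|j _]; last exact: scale0r.
rewrite -[RHS]c0; apply: eq_bigr => j _.
by rewrite (nth_map 0%N) ?size_tuple // (tnth_nth 0%N).
Qed.

Lemma card_span_mono : #|L| = (q ^ (m * s))%N.
Proof. by rewrite card_vspace dim_span_mono card_ext expnM. Qed.

Definition frob_eval (c : 'I_s -> V) (x : V) : V := \sum_i c i * x ^+ (q ^ l_ i).

Fact frob_eval_linear c : linear (frob_eval c).
Proof.
move=> a x y; rewrite /frob_eval scaler_sumr -big_split; apply: eq_bigr => i _.
by rewrite frobenius_linear mulrDr -scalerAr.
Qed.
HB.instance Definition _ c := GRing.isLinear.Build F V V _
  (frob_eval c) (frob_eval_linear c).

(** The substitution behind cyclicity: shifting a word replaces x by x / alpha. *)
Lemma span_mono_twist R a : R \in L ->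
  exists2 R', R' \in L & forall x, (R' : {poly V}).[x] = a * (R : {poly V}).[a * x].
Proof.
case/span_monoP=> c ->; exists (frob_poly (fun i => a * c i * a ^+ (q ^ l_ i))).
  by apply/span_monoP; eexists.
move=> x; rewrite !frob_poly_horner mulr_sumr; apply: eq_bigr => i _.
by rewrite exprMn !mulrA.
Qed.

Definition frob_form c := trace_form (linfun (frob_eval c)).

(** The sum of the linear map of R and of its adjoint for the trace pairing; by
    frob_polarP it represents the polar form. *)
Definition frob_polar (c : 'I_s -> V) (x : V) : V :=
  \sum_i (c i * x ^+ (q ^ l_ i) + (c i * x) ^+ (q ^ (m - l_ i))).

Lemma QR_frob_poly c : QR (frob_poly c) = qf (frob_form c).
Proof.
apply/funext => x; rewrite /QR /qf /frob_form trace_formE lfunE /=.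
by rewrite frob_poly_horner.
Qed.

Lemma frob_polarP c x y : polar (frob_form c) x y = Tr (frob_polar c x * y).
Proof.
rewrite polarE !trace_formE !lfunE /= /frob_polar big_split /= mulrDl TrD addrC.
congr (_ + _); first by rewrite mulrC.
rewrite /frob_eval mulr_sumr mulr_suml.
rewrite !(big_morph _ (@TrD F K) (@Tr0 F K)); apply: eq_bigr => i _.
exact: (@Tr_adjoint F K (l_ i) (c i) x y (lelm i)).
Qed.

Hypothesis ell_pos : forall l : nat, l \in ell -> (0 < l)%N.

Let lt_sub i : (m - l_ i < m)%N.
Proof.
have l_gt0 : (0 < l_ i)%N by apply: ell_pos; apply: mem_tnth.
by have := ltlm i; lia.
Qed.

Let sub_neq i j : (m - l_ i == l_ j)%N = false.
Proof. by apply/eqP; have := ltlm i; have := ltlm j; lia. Qed.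

(** As a polynomial in x, frob_polar c has degree less than q ^ m, so it vanishes
    identically only if its coefficients do; the exponents q ^ l_i are not among
    the q ^ (m - l_j), hence c j is one of these coefficients. *)
Lemma frob_polar_eq0 c : (forall x, frob_polar c x = 0) -> c =1 fun=> 0.
Proof.
move=> c0 j.
pose p : {poly V} := \sum_i (c i *: 'X^(q ^ l_ i)
  + (c i) ^+ (q ^ (m - l_ i)) *: 'X^(q ^ (m - l_ i))).
have p0 : p = 0.
  apply/eqP/negPn/negP => p_neq0.
  have root_p : all (root p) (enum V).
    apply/allP => x _; rewrite /root /p horner_sum -[X in _ == X](c0 x) /frob_polar; apply/eqP.
    apply: eq_bigr => i _; rewrite hornerD !hornerZ !hornerXn exprMn.
    by [].
  have := max_poly_roots p_neq0 root_p (enum_uniq _).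
  rewrite -cardT card_ext ltnNge; case/negP.
  apply: (leq_trans (size_sum _ _ _)); apply/bigmax_leqP => i _.
  apply: (leq_trans (size_polyD _ _)); rewrite geq_max.
  by rewrite !(leq_trans (size_scale_leq _ _)) ?size_polyXn ?ltn_exp2l ?lt_sub ?lt_l.
have := congr1 (fun p : {poly V} => p`_(q ^ l_ j)) p0; rewrite coef0 => <-.
rewrite /p coef_sum (bigD1 j) //= coefD !coefZ !coefXn eqxx mulr1 big1 => [|i ij].
  by rewrite (inj_eq expq_inj) eq_sym sub_neq mulr0 !addr0.
rewrite coefD !coefZ !coefXn tnth_ell_eq eq_sym (negbTE ij) mulr0 add0r.
by rewrite (inj_eq expq_inj) eq_sym sub_neq mulr0.
Qed.

(** All that the weight computations require of R. *)
Lemma span_mono_form R : R \in L -> exists (S : 'Hom(V, 'Hom(V, F^o))) (P : V -> V),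
  [/\ forall x y, polar S x y = Tr (P x * y), QR R = qf S
    & R != 0 -> ~~ odd (qrank (QR R)) -> (0 < qrank (QR R))%N].
Proof.
case/span_monoP=> c ->; exists (frob_form c), (frob_polar c).
split; [exact: frob_polarP | exact: QR_frob_poly | move=> R0 even_r].
rewrite lt0n; apply: contra R0 => /eqP r0.
rewrite QR_frob_poly in even_r r0; have [_ dimR] := qrank_even even_r.
have radT : radical (frob_form c) fullv = fullv.
  by apply/eqP; rewrite eqEdim subvf /= -[X in (X <= _)%N]dimR r0 add0n.
have c0 : c =1 fun=> 0.
  apply: frob_polar_eq0 => x; apply/eqP/negPn/negP => /Tr_nondegenerate[y].
  rewrite -frob_polarP; have : x \in radical (frob_form c) fullv by rewrite radT memvf.
  by case/radicalP=> _ ->; rewrite ?memvf ?eqxx.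
by rewrite /frob_poly big1 // => i _; rewrite c0 scale0r.
Qed.

End FrobeniusPolynomials.

(** * The codes and their weights *)
Section LinearCodeCriterion.

Variables (F : finFieldType) (n : nat).

Lemma linear_code_card (C : {set 'rV[F]_n}) (k : nat) :
    0 \in C -> (forall a, {in C &, forall c c', a *: c + c' \in C}) ->
  #|C| = (#|F| ^ k)%N -> linear_code_of_dim C k.
Proof.
move=> C0 Clin cardC.
have spanC : C =i <<enum C>>%VS.
  move=> c; apply/idP/idP => [Cc|]; first by rewrite memv_span ?mem_enum.
  move=> spc; rewrite (coord_span (spc : c \in <<in_tuple (enum C)>>%VS)).
  elim/big_ind: _ => // [x y Cx Cy|i _]; first by rewrite -[x]scale1r Clin.
  by rewrite -[_ *: _]addr0 Clin // -mem_enum mem_nth.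
exists <<enum C>>%VS => //; apply/eqP.
rewrite -(@eqn_exp2l #|F|) ?finNzRing_gt1 // -cardC -card_vspace.
by rewrite (eq_card spanC).
Qed.

End LinearCodeCriterion.

Section Codes.

Variables (F : finFieldType) (K : fieldExtType F) (s : nat) (ell : s.-tuple nat).
Local Notation V := (finvect_type K).
Local Notation m := (\dim {:K}).
Local Notation q := #|F|.
Local Notation polyK := {poly_(#|F| ^ \dim {:K}) (finvect_type K)}.
Local Notation L := (span_mono K ell).
Local Notation Q := (q%:R : rat).
Local Notation W := (Q ^ m%:Z - Q ^ (m%:Z - 1)).
Local Notation n := (q ^ m).-1.
Local Notation sg k := ((-1) ^+ k : rat).

Hypothesis s_gt0 : (0 < s)%N.
Hypothesis ell_uniq : uniq ell.
Hypothesis ell_pos : forall l : nat, l \in ell -> (0 < l)%N.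
Hypothesis ell_small : forall l : nat, l \in ell -> (2 * l < m)%N.
Hypothesis evenL : even_rank_family L.

Variable alpha : V.
Hypothesis prim_alpha : n.-primitive_root alpha.

Let q_gt1 : (1 < q)%N.
Proof. exact: finNzRing_gt1. Qed.

Let Q_neq0 : Q != 0.
Proof. by rewrite gt_eqF // ltr0n ltnW. Qed.

Let m_gt2 : (2 < m)%N.
Proof.
have ell0 : tnth ell (Ordinal s_gt0) \in ell := mem_tnth _ _.
by have := ell_pos ell0; have := ell_small ell0; lia.
Qed.

Lemma alpha_neq0 : alpha != 0.
Proof.
apply/negP => /eqP a0; have n_gt0 := prim_order_gt0 prim_alpha.
have := prim_expr_order prim_alpha; rewrite a0 expr0n gtn_eqF //.
by move/esym/eqP; rewrite oner_eq0.
Qed.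

Lemma card_coordinates (p : pred V) :
  #|[set i : 'I_n | p (alpha ^+ i)]| = #|[set x | (x != 0) && p x]|.
Proof.
have inj_alpha : injective (fun i : 'I_n => alpha ^+ i).
  move=> i j /eqP; rewrite (eq_prim_root_expr prim_alpha) !modn_small //.
  by move/eqP/val_inj.
have im_alpha : [set alpha ^+ i | i : 'I_n] = [set x | x != 0].
  apply/eqP; rewrite eqEcard; apply/andP; split.
    by apply/subsetP => _ /imsetP[i _ ->]; rewrite inE expf_neq0 ?alpha_neq0.
  rewrite (card_imset _ inj_alpha) card_ord -(card_ext K) -(cardC1 (0 : V)).
  by apply: eq_leq; apply: eq_card => x; rewrite !inE.
rewrite -(card_imset _ inj_alpha); apply: eq_card => x; rewrite [RHS]inE.
apply/imsetP/andP => [[i + ->]|[x0 px]].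
  by rewrite inE expf_neq0 ?alpha_neq0.
have : x \in [set alpha ^+ i | i : 'I_n] by rewrite im_alpha inE.
by case/imsetP => i _ xE; exists i; rewrite // inE -xE.
Qed.

(** The point 0, which is not a coordinate, is a nonzero of the function exactly
    when c <> 0. *)
Lemma weight_word2 (S : 'Hom(V, 'Hom(V, F^o))) (R : polyK) b c : QR R = qf S ->
  (weight (word2 alpha R b c))%:R = Q ^ m%:Z - (zeros S b c)%:R - (c != 0)%:R :> rat.
Proof.
move=> RS; pose f (x : V) := qf S x + Tr (b * x) + c.
have fE (x : V) : Tr (x * (R : {poly V}).[x] + b * x) + c = f x.
  by rewrite TrD /f -RS.
have f0 : f 0 = c by rewrite /f qf0 mulr0 Tr0 !add0r.
have -> : weight (word2 alpha R b c) = #|[set x | (x != 0) && (f x != 0)]|.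
  rewrite -(card_coordinates (fun x => f x != 0)).
  by apply: eq_card => i; rewrite !inE mxE -fE.
have -> : Q ^ m%:Z = #|V|%:R by rewrite card_ext natrX.
rewrite -(cardsC [set x : V | f x == 0]) natrD.
rewrite (_ : zeros S b c = #|[set x : V | f x == 0]|) // [X in X - _ - _]addrC addrK.
rewrite (cardsD1 0 (~: _)) natrD !inE f0 [X in X - _]addrC addrK; congr _%:R.
by apply: eq_card => x; rewrite !inE.
Qed.

Definition form_type (R : polyK) : nat := if qtype1 (QR R) then 1%N else 2%N.

Lemma frequencies_of_form (R : polyK) (w : rat) : R \in L ->
  [/\ #|[set b | (weight (word2 alpha R b 0))%:R == w]|%:R =
      (W == w)%:R * (Q ^ m%:Z - Q ^ (qrank (QR R) : nat)%:Z)
      + unit_row1 K (qrank (QR R)) (form_type R) w,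
    \sum_(c : F | c != 0) #|[set b | (weight (word2 alpha R b c))%:R == w]|%:R =
      (W - 1 == w)%:R * ((Q - 1) * (Q ^ m%:Z - Q ^ (qrank (QR R) : nat)%:Z))
      + unit_row2 K (qrank (QR R)) (form_type R) w
  & forall i, i \in [:: 1%N; 2%N] ->
      (if i == 1%N then qtype1 (QR R) else qtype3 (QR R)) = (i == form_type R)].
Proof.
move=> LR; have evenR := evenL LR.
have [S [P [polarP RS _]]] := span_mono_form ell_small ell_uniq ell_pos LR.
have evenS := evenR; rewrite RS in evenS.
have [e levelE] := level_qrank evenS.
have t1 : qtype1 (QR R) = ~~ e.
  have := has_sign_level evenS levelE false.
  by rewrite expr0 -RS /qtype1 => ->; case: (e).
have t3 : qtype3 (QR R) = e.
  have := has_sign_level evenS levelE true.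
  by rewrite expr1 -RS /qtype3 => ->; case: (e).
have -> : form_type R = e.+1 by rewrite /form_type t1; case: (e).
split.
- rewrite RS -(card_zeros_linear polarP evenS levelE); congr _%:R.
  by apply: eq_card => b; rewrite !inE (weight_word2 _ _ RS) eqxx subr0.
- rewrite RS -(card_zeros_affine polarP evenS levelE); apply: eq_bigr => c c0.
  congr _%:R; apply: eq_card => b.
  by rewrite !inE (weight_word2 _ _ RS) c0.
- by move=> i; rewrite !inE => /orP[]/eqP->; rewrite /= ?t1 ?t3; case: (e).
Qed.

Lemma QR0 (x : V) : QR (0 : polyK) x = 0.
Proof. by rewrite /QR raddf0 horner0 mulr0 Tr0. Qed.

(** A word of weight 0 comes from a function with at least q ^ m - 1 zeros. This
    exceeds the number of zeros allowed by a form of positive rank, and also the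
    number of zeros of a nonzero affine function. *)
Lemma weight0_word2 (R : polyK) b c : R \in L ->
  weight (word2 alpha R b c) = 0%N -> [/\ R = 0, b = 0 & c = 0].
Proof.
move=> LR w0; have evenR := evenL LR.
have [S [P [polarP RS rank_gt0]]] := span_mono_form ell_small ell_uniq ell_pos LR.
have cz : ((c != 0)%:R : rat) <= 1 by case: (c != 0).
have wE := weight_word2 b c RS.
rewrite w0 in wE.
have R0 : R = 0.
  apply/eqP/negPn/negP => R0.
  have evenS := evenR; rewrite RS in evenS; have {}rank_gt0 := rank_gt0 R0 evenR.
  rewrite RS in rank_gt0.
  have := zeros_lt polarP evenS b c m_gt2 rank_gt0.
  by rewrite -subr_gt0; lra.
have qS0 x : qf S x = 0 by rewrite -RS R0 QR0.
have cardV : (3 < #|V|)%N.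
  rewrite card_ext (leq_trans (_ : 4 <= 2 ^ m)%N) ?leq_exp2r ?(ltnW (ltnW m_gt2)) //.
  by rewrite -[4%N]/(2 ^ 2)%N leq_exp2l // ltnW.
have zE : #|V|%:R - (zeros S b c)%:R = (c != 0)%:R :> rat.
  by rewrite card_ext natrX exprnP; lra.
have b0 : b = 0.
  apply/eqP/negPn/negP => /Tr_nondegenerate[x bx].
  have zb : (q * zeros S b c = #|V|)%N.
    have bx' : trace_lfun b x != 0 by rewrite trace_lfunE.
    have := card_lfun_fiber (- c) (memvf x) bx'; rewrite card_vspacef => <-.
    congr (_ * _)%N; apply: eq_card => y.
    by rewrite !inE memvf qS0 add0r trace_lfunE -addr_eq0.
  have : #|V|%:R <= (zeros S b c)%:R + 1 :> rat.
    by rewrite -lerBlDl zE.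
  rewrite natr1 ler_nat -zb; have := leq_mul2r (zeros S b c) 2 q.
  by rewrite q_gt1 orbT; move: cardV; rewrite -zb; lia.
split=> //; apply/eqP/negPn/negP => c0; move: zE; rewrite c0.
rewrite (_ : zeros S b c = 0%N).
  by move=> /eqP; rewrite subr0 pnatr_eq1 gtn_eqF // ltnW // ltnW.
apply: eq_card0 => x; rewrite inE b0 mul0r qS0 Tr0 !add0r; exact/negbTE.
Qed.

Lemma word2_linear (a : F) (R R' : polyK) b b' c c' :
  word2 alpha (a%:A *: R + R') (a *: b + b') (a * c + c')
    = a *: word2 alpha R b c + word2 alpha R' b' c'.
Proof.
apply/rowP => i; rewrite !mxE /=; set x := alpha ^+ i.
have hE : ((a%:A *: R + R' : polyK) : {poly V}).[x]
    = a *: (R : {poly V}).[x] + (R' : {poly V}).[x].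
  transitivity ((a%:A *: (R : {poly V}) + (R' : {poly V})).[x]) => //.
  by rewrite hornerD hornerZ mulr_algl.
rewrite hE !TrD mulrDr mulrDl -scalerAr -scalerAl !TrD !TrZ.
by ring.
Qed.

(** A common form of the two codes: the constant term is 0 for the first and
    arbitrary for the second. *)
Definition trace_code (B : {set F}) : {set 'rV[F]_n} :=
  [set word2 alpha t.1 t.2.1 t.2.2 | t : polyK * (V * F)
    in [set t : polyK * (V * F) | (t.1 \in L) && (t.2.2 \in B)]].

Lemma word2_inj :
  {in [set t : polyK * (V * F) | t.1 \in L] &,
    injective (fun t => word2 alpha t.1 t.2.1 t.2.2)}.
Proof.
move=> [R [b c]] [R' [b' c']]; rewrite !inE /= => LR LR' eqw.
have w0 := word2_linear (-1) R' R b' b c' c.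
rewrite eqw !scaleN1r addNr mulN1r in w0.
have [||R0 b0 c0] := @weight0_word2 (- R' + R) (- b' + b) (- c' + c).
- by rewrite rpredD ?rpredN.
- by rewrite w0; apply: eq_card0 => i; rewrite !inE mxE eqxx.
by move: R0 b0 c0; rewrite !(addrC (- _)) => /subr0_eq -> /subr0_eq -> /subr0_eq ->.
Qed.

Lemma card_family (B : {set F}) (p : polyK -> V -> F -> bool) :
  (#|[set t : polyK * (V * F) |
      [&& t.1 \in L, t.2.2 \in B & p t.1 t.2.1 t.2.2]]|
   = \sum_(R in L) \sum_(c in B) #|[set b | p R b c]|)%N.
Proof.
rewrite -sum1_card big_mkcond /=.
pose G (R : polyK) (t : V * F) : nat :=
  (if (R \in L) && (t.2 \in B) && p R t.1 t.2 then 1 else 0)%N.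
transitivity (\sum_R \sum_t G R t)%N.
  by rewrite pair_bigA; apply: eq_bigr => t _; rewrite inE /G andbA.
rewrite [RHS]big_mkcond; apply: eq_bigr => R _.
transitivity (\sum_b \sum_c G R (b, c))%N.
  by rewrite pair_bigA; apply: eq_bigr => -[b c] _.
rewrite exchange_big /G /=; have [LR|_] := boolP (R \in L); last first.
  by rewrite big1 // => c _; rewrite big1.
rewrite [RHS]big_mkcond; apply: eq_bigr => c _ /=.
have [Bc|_] := boolP (c \in B); last by rewrite big1.
by rewrite -sum1_card [RHS]big_mkcond; apply: eq_bigr => b _; rewrite inE.
Qed.

Lemma card_trace_code (B : {set F}) (p : pred 'rV[F]_n) :
  (#|[set w in trace_code B | p w]|
   = \sum_(R in L) \sum_(c in B) #|[set b | p (word2 alpha R b c)]|)%N.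
Proof.
rewrite -card_family.
rewrite -(card_in_imset (f := fun t : polyK * (V * F) => word2 alpha t.1 t.2.1 t.2.2)).
  apply: eq_card => w; rewrite inE; apply/andP/imsetP.
    case=> /imsetP[t + ->]; rewrite inE => /andP[Lt Bt] pt.
    by exists t; rewrite // inE Lt Bt.
  case=> t; rewrite inE => /and3P[Lt Bt pt] ->; split=> //.
  by apply/imsetP; exists t; rewrite // inE Lt Bt.
move=> t t'; rewrite !inE => /and3P[Lt _ _] /and3P[Lt' _ _].
by apply: word2_inj; rewrite inE.
Qed.

Lemma card_trace_codeT (B : {set F}) :
  #|trace_code B| = (q ^ (m * s) * #|B| * q ^ m)%N.
Proof.
have -> : #|trace_code B| = #|[set w in trace_code B | predT w]|.
  by apply: eq_card => w; rewrite inE andbT.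
rewrite card_trace_code.
under eq_bigr => R _ do under eq_bigr => c _ do rewrite cardsT card_ext.
by rewrite !sum_nat_const (card_span_mono ell_small ell_uniq) mulnA.
Qed.

Lemma code1E : code1 L alpha = trace_code [set 0].
Proof.
apply/setP => w; apply/imset2P/imsetP => [[R b LR _ ->]|[[R [b c]]]].
  exists (R, (b, 0)); first by rewrite !inE /= LR eqxx.
  by apply/rowP => i; rewrite !mxE /= addr0.
rewrite inE /= => /andP[LR /set1P->] ->; exists R b; rewrite ?inE //.
by apply/rowP => i; rewrite !mxE /= addr0.
Qed.

Lemma code2E : code2 L alpha = trace_code setT.
Proof.
apply/setP => w; apply/imset2P/imsetP => [[R t LR _ ->]|[[R t]]].
  by exists (R, t); rewrite // !inE /= LR.
by rewrite inE /= => /andP[LR _] ->; exists R t; rewrite ?inE.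
Qed.

Lemma trace_code_linear (B : {set F}) (k : nat) :
    0 \in B -> (forall a, {in B &, forall c c', a * c + c' \in B}) ->
  #|B| = (q ^ k)%N -> linear_code_of_dim (trace_code B) (m * (s + 1) + k).
Proof.
move=> B0 Blin cardB; apply: linear_code_card.
- apply/imsetP; exists (0, (0, 0)); first by rewrite inE mem0v.
  have h0 x : ((0 : polyK) : {poly V}).[x] = 0 by exact: horner0.
  by apply/rowP => i; rewrite !mxE /= h0 mulr0 mul0r !addr0 Tr0.
- move=> a _ _ /imsetP[[R [b c]] + ->] /imsetP[[R' [b' c']] + ->].
  rewrite !inE /= => /andP[LR Bc] /andP[LR' Bc'].
  rewrite -word2_linear; apply/imsetP.
  exists (a%:A *: R + R', (a *: b + b', a * c + c')) => //.
  by rewrite inE /= rpredD ?rpredZ //= Blin.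
- by rewrite card_trace_codeT cardB -!expnD; congr (_ ^ _)%N; ring.
Qed.

Lemma trace_code_cyclic (B : {set F}) : cyclic_code (trace_code B).
Proof.
move=> _ /imsetP[[R [b c]] + ->]; rewrite inE /= => /andP[LR Bc].
have [R' LR' R'E] := span_mono_twist ell_small alpha^-1 LR.
apply/imsetP; exists (R', (alpha^-1 * b, c)); first by rewrite inE /= LR' Bc.
apply/rowP => i; rewrite !mxE /= R'E.
have -> : alpha ^+ (ord_pred i) = alpha^-1 * alpha ^+ i.
  apply: (mulfI alpha_neq0); rewrite mulVKf ?alpha_neq0 // -exprS /=.
  apply/eqP; rewrite (eq_prim_root_expr prim_alpha) -addn1 modnDml addn1.
  by rewrite prednK ?modnDr // addn_gt0 (prim_order_gt0 prim_alpha) orbT.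
by congr (Tr _ + _); ring.
Qed.

Lemma form_type_range R : form_type R \in [:: 1%N; 2%N].
Proof. by rewrite /form_type; case: ifP. Qed.

Lemma MtypeE (r : nat) i : i \in [:: 1%N; 2%N] -> (Mtype L r i)%:R =
  \sum_(R in L | R != 0) ((qrank (QR R) == r :> nat) && (form_type R == i))%:R :> rat.
Proof.
move=> i12; rewrite /Mtype -sum1_card natr_sum [LHS]big_mkcond [RHS]big_mkcond /=.
apply: eq_bigr => R _; rewrite inE.
have [LR|//=] := boolP (R \in L); have [_ _ tyE] := frequencies_of_form 0 LR.
rewrite /= tyE // [i == _]eq_sym.
by case: (R != 0) => //=; case: (_ && _).
Qed.

(** Grouping by rank and type is undone: Mtype counts the nonzero R with a given
    rank and type, so the rows add up to a sum over R. *)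
Lemma sum_rows (rows : nat -> nat -> seq (rat * rat)) (u : nat -> nat -> rat) (w : rat) :
    (forall r i, \sum_(p <- rows r i | p.1 == w) p.2 = (Mtype L r i)%:R * u r i) ->
  \sum_(p <- flatten [seq rows r i | r : 'I_m.+1 <- enum (ranks L),
                                     i : nat <- [:: 1%N; 2%N]] | p.1 == w) p.2 =
    \sum_(R in L | R != 0) u (qrank (QR R)) (form_type R).
Proof.
move=> rowsE; rewrite big_flatten big_allpairs_dep /= big_enum /=.
transitivity (\sum_(r in ranks L) \sum_(R in L | R != 0) \sum_(i <- [:: 1%N; 2%N])
    ((qrank (QR R) == r) && (form_type R == i))%:R * u r i).
  apply: eq_bigr => r _; rewrite [RHS]exchange_big [LHS]big_seq [RHS]big_seq.
  apply: eq_bigr => i i12.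
  by rewrite rowsE MtypeE // mulr_suml.
rewrite exchange_big; apply: eq_bigr => R /andP[LR _].
have rR : qrank (QR R) \in ranks L by apply: imset_f.
rewrite (bigD1 (qrank (QR R))) //= [X in _ + X]big1 => [|r /andP[_ rneq]].
  rewrite eqxx !big_cons big_nil !addr0 /=; have := form_type_range R.
  by rewrite !inE => /orP[]/eqP-> /=; rewrite mul1r mul0r ?addr0 ?add0r.
by rewrite !big_cons big_nil eq_sym (negbTE rneq) !mul0r !addr0.
Qed.

Lemma balancedE :
  balanced L = \sum_(R in L) (Q ^ m%:Z - Q ^ (qrank (QR R) : nat)%:Z).
Proof.
rewrite /balanced.
transitivity (\sum_(r in ranks L) \sum_(R in L)
    (qrank (QR R) == r)%:R * (Q ^ m%:Z - Q ^ (r : nat)%:Z)).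
  apply: eq_bigr => r _; rewrite -mulr_suml; congr (_ * _).
  rewrite /Mrank -sum1_card natr_sum [LHS]big_mkcond [RHS]big_mkcond /=.
  apply: eq_bigr => R _; rewrite inE; case: (R \in L) => //=.
  by rewrite val_eqE; case: (_ == r).
rewrite exchange_big; apply: eq_bigr => R LR.
have rR : qrank (QR R) \in ranks L by apply: imset_f.
rewrite (bigD1 (qrank (QR R))) //= big1 => [|r /andP[_ rneq]].
  by rewrite eqxx mul1r addr0.
by rewrite eq_sym (negbTE rneq) mul0r.
Qed.

(** The zero form is excluded from Mtype but obeys the same formulas, as a form of
    rank 0 and type 1. By unit_row1_0 and unit_row2_0 its share consists of the
    words of weight 0 and of weight q ^ m - 1 coming from constants. *)
Lemma zero_form : (qrank (QR (0 : polyK)) = 0%N :> nat) /\ form_type 0 = 1%N.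
Proof.
have L0 : (0 : polyK) \in L by apply: mem0v.
have [S [P [_ RS _]]] := span_mono_form ell_small ell_uniq ell_pos L0.
have evenS := evenL L0; rewrite RS in evenS.
have qS0 x : qf S x = 0 by rewrite -RS QR0.
have radT : radical S fullv = fullv.
  apply/vspaceP => x; rewrite memvf; apply/radicalP; split=> [|y _]; first exact: memvf.
  by have := qfD S x y; rewrite !qS0 !add0r.
have rank0 : qrank (QR (0 : polyK)) = 0%N :> nat.
  have [_] := qrank_even evenS; rewrite radT -[X in _ = X]add0n RS.
  exact: addIn.
split=> //; rewrite /form_type /qtype1 /has_sign rank0 /=.
rewrite (_ : #|_| = #|V|); last by apply: eq_card => x; rewrite !inE QR0 eqxx.
rewrite card_ext natrX exprnP subr0 mul1r.
rewrite [X in _ == _ + _ * X](expfzDr) // [X in _ == X + _](expfzDr) // exprN1.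
by rewrite ifT //; apply/eqP; field.
Qed.

Lemma sum_if (P : bool) (x : rat) : (if P then x else 0) = P%:R * x.
Proof. by case: P; rewrite ?mul1r ?mul0r. Qed.

Lemma unit_row1_0 w : unit_row1 K 0 1 w = (0 == w)%:R.
Proof.
rewrite /unit_row1 /= !subr0 !sub0r exprN1 expr1 sqrrN expr1n !mul1r !mulN1r.
have m1E : Q ^ (m%:Z - 1) = Q ^ m%:Z / Q by rewrite expfzDr // exprN1.
rewrite [X in _ + _ * X](_ : _ = 0) ?mulr0 ?addr0; last by rewrite subrr mul0r.
rewrite [X in X == w](_ : _ = 0); last by rewrite m1E; field.
by rewrite [X in _ * X](_ : _ = 1) ?mulr1 //; field.
Qed.

Lemma unit_row2_0 w : unit_row2 K 0 1 w = (Q ^ m%:Z - 1 == w)%:R * (Q - 1).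
Proof.
rewrite /unit_row2 /= !subr0 !sub0r exprN1 expr1 sqrrN expr1n !mul1r !mulN1r.
rewrite subrr mul0r mulr0 add0r expr0z subrK mul1r; congr ((_ == w)%:R * _).
by ring.
Qed.

Lemma sum_table1 w : \sum_(p <- table1 L | p.1 == w) p.2 =
  (W == w)%:R * balanced L
  + \sum_(R in L) unit_row1 K (qrank (QR R)) (form_type R) w.
Proof.
have [r0 t0] := zero_form.
rewrite /table1 big_cat /= (sum_rows (u := fun r i => unit_row1 K r i w)).
  rewrite [in RHS](bigD1 0) ?mem0v //= r0 t0 unit_row1_0 !big_cons big_nil /= !sum_if.
  by case: eqP => _; case: eqP => _ /=; ring.
move=> r i; rewrite /rows1 !big_cons big_nil /= !sum_if /unit_row1.
by case: eqP => _; case: eqP => _ /=; ring.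
Qed.

Lemma sum_table2 w : \sum_(p <- table2 L | p.1 == w) p.2 =
  \sum_(p <- table1 L | p.1 == w) p.2
  + (W - 1 == w)%:R * ((Q - 1) * balanced L)
  + \sum_(R in L) unit_row2 K (qrank (QR R)) (form_type R) w.
Proof.
have [r0 t0] := zero_form.
have catE (t1 t2 t3 : seq (rat * rat)) :
    \sum_(p <- t1 ++ t2 ++ t3 | p.1 == w) p.2 = \sum_(p <- t1 | p.1 == w) p.2
      + (\sum_(p <- t2 | p.1 == w) p.2 + \sum_(p <- t3 | p.1 == w) p.2).
  by rewrite !big_cat.
rewrite /table2 catE -[RHS]addrA; congr (_ + _).
rewrite (sum_rows (u := fun r i => unit_row2 K r i w)).
  rewrite [in RHS](bigD1 0) ?mem0v //= r0 t0 unit_row2_0 !big_cons big_nil /= !sum_if.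
  by case: eqP => _; case: eqP => _ /=; ring.
move=> r i; rewrite /rows2 !big_cons big_nil /= !sum_if /unit_row2.
by case: eqP => _; case: eqP => _ /=; ring.
Qed.

Lemma code1_weight_distribution : has_weight_distribution (code1 L alpha) (table1 L).
Proof.
move=> w; rewrite code1E (card_trace_code _ (fun v => (weight v)%:R == w)) natr_sum.
rewrite sum_table1 balancedE mulr_sumr -big_split; apply: eq_bigr => R LR.
by rewrite big_set1; have [-> _ _] := frequencies_of_form w LR.
Qed.

Lemma code2_weight_distribution : has_weight_distribution (code2 L alpha) (table2 L).
Proof.
move=> w; rewrite code2E (card_trace_code _ (fun v => (weight v)%:R == w)) natr_sum.
rewrite sum_table2 sum_table1 balancedE !mulr_sumr -!big_split; apply: eq_bigr => R LR.
rewrite (bigD1 0) ?inE //= natrD natr_sum.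
have [-> affE _] := frequencies_of_form w LR.
rewrite (eq_bigl (fun c => c != 0)); last by move=> c; rewrite ?in_setT.
by rewrite affE -!addrA.
Qed.

End Codes.

Local Close Scope ring_scope.

Theorem theorem3p4 (q m s : nat) (F : finFieldType) (K : fieldExtType F)
    (ell : s.-tuple nat) (alpha : finvect_type K) :
  #|F| = q -> \dim {:K} = m ->
  ((q ^ m)%N.-1.-primitive_root alpha)%R ->
  (0 < s)%N -> sorted ltn ell ->
  (forall l, l \in ell -> (1 <= l)%N /\ (2 * l < m)%N) ->
  let L := span_mono K ell in
  even_rank_family L ->
  [/\ linear_code_of_dim (code1 L alpha) (m * (s + 1)),
      linear_code_of_dim (code2 L alpha) (m * (s + 1) + 1),
      cyclic_code (code1 L alpha) /\ cyclic_code (code2 L alpha),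
      has_weight_distribution (code1 L alpha) (table1 L)
    & has_weight_distribution (code2 L alpha) (table2 L)].
Proof.
move=> <- <- prim_alpha s_gt0 ell_sorted ell_bounds L evenL.
have ell_uniq : uniq ell.
  by apply: sorted_uniq ell_sorted; [exact: ltn_trans | exact: ltnn].
have ell_pos (l : nat) : l \in ell -> 0 < l by case/ell_bounds.
have ell_small (l : nat) : l \in ell -> 2 * l < \dim {:K} by case/ell_bounds.
split.
- rewrite code1E -[X in linear_code_of_dim _ X]addn0.
  apply: (trace_code_linear s_gt0 ell_uniq ell_pos ell_small evenL prim_alpha).
  + by rewrite inE.
  + by move=> a c c' /set1P-> /set1P->; rewrite inE mulr0 addr0.
  + by rewrite cards1.
- rewrite code2E.
  apply: (trace_code_linear s_gt0 ell_uniq ell_pos ell_small evenL prim_alpha).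
  + by rewrite inE.
  + by move=> a c c' _ _; rewrite inE.
  + by rewrite cardsT expn1.
- by rewrite code1E code2E; split; apply: trace_code_cyclic.
- exact: code1_weight_distribution.
- exact: code2_weight_distribution.
Qed.
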